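(* Consider the algorithm ''Reachability algorithm (automated tuning)'' specified in full in the context, applied to a linear system $\dot x(t)=Ax(t)+Bu(t)+p$ with $A\in\mathbb{R}^{n\times n}$, $B\in\mathbb{R}^{n\times m}$, $p\in\mathbb{R}^n$, an initial set $\mathcal{X}^0=\langle c_x,G_x\rangle_Z\subset\mathbb{R}^n$, an input set $\mathcal{U}=\langle c_u,G_u\rangle_Z\subset\mathbb{R}^m$, a time horizon $t_{\mathrm{end}}>0$, and a parameter $\zeta\in[0,1)$. For every error bound $\varepsilon_{\max}>0$, the algorithm terminates in finite time (i.e. after finitely many iterations of all its loops).
   Context: **Sets and operators.** A zonotope is $\langle c,G\rangle_Z=\{c+\sum_{i=1}^{\gamma}G_{(\cdot,i)}\alpha_i : \alpha_i\in[-1,1]\}$ with $c\in\mathbb{R}^n$, $G\in\mathbb{R}^{n\times\gamma}$; its order is $\gamma/n$. $\oplus$ is the Minkowski sum; for zonotopes $M\langle c,G\rangle_Z=\langle Mc,MG\rangle_Z$ and $\langle c_1,G_1\rangle_Z\oplus\langle c_2,G_2\rangle_Z=\langle c_1+c_2,[G_1\ G_2]\rangle_Z$. $\operatorname{box}(\mathcal{S})$ is the tightest axis-aligned box containing $\mathcal{S}$, $\operatorname{rad}(\mathcal{S})$ is the radius of the smallest Euclidean ball centered at the origin containing $\mathcal{S}$, and $\operatorname{err}(\mathcal{S}):=\operatorname{rad}(\operatorname{box}(\mathcal{S}))$. An interval matrix is $[\underline{M},\overline{M}]=\{M:\underline{M}\le M\le\overline{M}\}$ (entrywise); sums of interval matrices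 and products of a real interval with a real matrix are taken in interval arithmetic; $\|[\underline{M},\overline{M}]\|_F$ is the maximum Frobenius norm of its elements. The product of an interval matrix with center $M_c$ and radius $M_r$ (i.e. $[M_c-M_r,M_c+M_r]$) with a zonotope $\langle c,G\rangle_Z$ (a vector being a zonotope without generators) is evaluated by the outer-approximation $\langle M_cc,[M_cG\ \ \operatorname{diag}(M_r(|c|+\sum_j|G_{(\cdot,j)}|))]\rangle_Z$. $|\cdot|$ is entrywise. **Order reduction.** For $\mathcal{Z}=\langle c,G\rangle_Z$ with $\gamma$ generators and desired order $\rho_d\ge1$, sort the generators so that $\|G_{(\cdot,\pi_1)}\|_1-\|G_{(\cdot,\pi_1)}\|_\infty\le\dots\le\|G_{(\cdot,\pi_\gamma)}\|_1-\|G_{(\cdot,\pi_\gamma)}\|_\infty$, let $\chi=\gamma-\lfloor(\rho_d-1)n\rfloor$ be the number of reduced generators (no reduction if $\chi\le0$), $G_{\mathrm{keep}}=[G_{(\cdot,\pi_{\chi+1})}\ \dots\ G_{(\cdot,\pi_\gamma)}]$, $G_{\mathrm{red}}=\operatorname{diag}(\sum_{i=1}^{\chi}|G_{(\cdot,\pi_i)}|)$ and $\operatorname{reduce}(\mathcal{Z},\rho_d)=\langle c,[G_{\mathrm{keep}}\ G_{\mathrm{red}}]\rangle_Z$. **Auxiliary quantities** for step size $\Delta t$ and truncation order $\eta$: $E(\Delta t,\eta)=e^{|A|\Delta t}-\sum_{i=0}^{\eta}\frac{(|A|\Delta t)^i}{i!}$, $\boldsymbol{\mathcal{E}}(\Delta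 t,\eta)=[-E(\Delta t,\eta),E(\Delta t,\eta)]$; $\mathcal{I}_i(\Delta t)=[(i^{-i/(i-1)}-i^{-1/(i-1)})\Delta t^i,\,0]$ for $i\ge2$; $\boldsymbol{\mathcal{F}}(\Delta t,\eta)=\bigoplus_{i=2}^{\eta}\mathcal{I}_i(\Delta t)\frac{A^i}{i!}\oplus\boldsymbol{\mathcal{E}}(\Delta t,\eta)$; $\boldsymbol{\mathcal{G}}(\Delta t,\eta)=\bigoplus_{i=2}^{\eta+1}\mathcal{I}_i(\Delta t)\frac{A^{i-1}}{i!}\oplus\boldsymbol{\mathcal{E}}(\Delta t,\eta)\Delta t$; $\boldsymbol{\mathcal{T}}^{(1)}=0$ and $\boldsymbol{\mathcal{T}}^{(j)}=\bigoplus_{i=2}^{j}\mathcal{I}_i(\Delta t)\frac{A^i}{i!}$ for $j\ge 2$. Further $\tilde u=Bc_u+p$, $\mathcal{U}_0=\langle 0,BG_u\rangle_Z$, $\tilde A_i=\frac{A^i\Delta t^{i+1}}{(i+1)!}$, $\widehat{\mathcal{P}}^{\mathcal{U}}_0(\Delta t)=\Delta t\,\mathcal{U}_0$, $\widehat{\mathcal{P}}^{\mathcal{U}}_\infty(\Delta t)=\bigoplus_{i=1}^{\eta}\tilde A_i\,\mathcal{U}_0\oplus\boldsymbol{\mathcal{E}}(\Delta t,\eta)\Delta t\,\mathcal{U}_0$, $\widehat{\mathcal{P}}^{\mathcal{U}}(\Delta t)=\widehat{\mathcal{P}}^{\mathcal{U}}_0(\Delta t)\oplus\widehat{\mathcal{P}}^{\mathcal{U}}_\infty(\Delta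 t)$, $\mathcal{P}^u(\Delta t)=A^{-1}(e^{A\Delta t}-I_n)\tilde u$ (understood as $\sum_{i\ge0}\frac{A^i\Delta t^{i+1}}{(i+1)!}\tilde u$ if $A$ is singular). **Errors in step $k$**, with current homogeneous solution $\mathcal{H}(t_k)=\langle c_h,G_h\rangle_Z$, $G_h\in\mathbb{R}^{n\times\gamma_h}$, step size $\Delta t_k$ and truncation order $\eta_k$: $\mathcal{C}=\boldsymbol{\mathcal{F}}(\Delta t_k,\eta_k)\mathcal{H}(t_k)\oplus\boldsymbol{\mathcal{G}}(\Delta t_k,\eta_k)\tilde u$; $\Delta\varepsilon^{\mathrm h}_k=2\operatorname{err}(\mathcal{C})+\sqrt{\gamma_h}\,\|(e^{A\Delta t_k}-I_n)G_h\|_2$; $\Delta\varepsilon^{\mathcal{U},\tau}_k=\operatorname{err}(e^{At_k}\widehat{\mathcal{P}}^{\mathcal{U}}(\Delta t_k))$; non-accumulating error $\Delta\varepsilon^{\mathrm n}_k=\Delta\varepsilon^{\mathrm h}_k+\Delta\varepsilon^{\mathcal{U},\tau}_k$; accumulating error $\Delta\varepsilon^{\mathrm a}_k=\operatorname{err}\big(e^{At_k}((\sum_{i=1}^{\eta_k}\tilde A_i)\mathcal{U}_0\oplus\boldsymbol{\mathcal{E}}(\Delta t_k,\eta_k)\Delta t_k\mathcal{U}_0)\big)+\operatorname{err}\big(e^{At_k}(\bigoplus_{i=1}^{\eta_k}\tilde A_i\mathcal{U}_0\oplus\boldsymbol{\mathcal{E}}(\Delta t_k,\eta_k)\Delta t_k\mathcal{U}_0)\big)$;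 reduction error $\Delta\varepsilon^{\mathrm r}_k(\rho_k)=\operatorname{err}(\langle0,G_{\mathrm{red}}\rangle_Z)$, where $G_{\mathrm{red}}$ is the matrix arising when reducing $\widehat{\mathcal{P}}^{\mathcal{U}}_0(t_{k+1})$ to order $\rho_k$. Accumulated errors: $\varepsilon^{\mathrm a}_0=\varepsilon^{\mathrm r}_0=0$, $\varepsilon^{\mathrm a}_{k+1}=\varepsilon^{\mathrm a}_k+\Delta\varepsilon^{\mathrm a}_k$, $\varepsilon^{\mathrm r}_{k+1}=\varepsilon^{\mathrm r}_k+\Delta\varepsilon^{\mathrm r}_k(\rho_k)$. **Error bounds.** $\overline{\varepsilon}^{\mathrm r}(t)=\frac{t}{t_{\mathrm{end}}}\zeta\varepsilon_{\max}$, $\overline{\varepsilon}^{\mathrm a}(t)=\frac{t}{t_{\mathrm{end}}}(1-\zeta)\varepsilon_{\max}$; in step $k$: $\overline{\varepsilon}^{\mathrm r,\tau}_k=\overline{\varepsilon}^{\mathrm r}(t_k+\Delta t_k)-\varepsilon^{\mathrm r}_k$, $\overline{\varepsilon}^{\mathrm a,\tau}_k=\overline{\varepsilon}^{\mathrm a}(t_k+\Delta t_k)-\varepsilon^{\mathrm a}_k$, $\overline{\varepsilon}^{\mathrm n,\tau}_k=\varepsilon_{\max}-\overline{\varepsilon}^{\mathrm r}(t_k+\Delta t_k)-\varepsilon^{\mathrm a}_k$. **Algorithm.** Initialize $k=0$, $t_0=0$, $\Delta t_{-1}=t_{\mathrm{end}}$, $\mathcal{H}(t_0)=\mathcal{X}^0$,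 $\mathcal{P}^u(t_0)=0$, $\widehat{\mathcal{P}}^{\mathcal{U}}_0(t_0)=\widehat{\mathcal{P}}^{\mathcal{U}}_\infty(t_0)=\{0\}$. While $t_k<t_{\mathrm{end}}$: 1. Set $\Delta t_k\leftarrow2\Delta t_{k-1}$. 2. Repeat: set $\Delta t_k\leftarrow\frac12\Delta t_k$, $t_{k+1}\leftarrow t_k+\Delta t_k$; let $\eta_k$ be the first integer $j\ge2$, found by incrementing $j$, for which the relative change satisfies $\|\boldsymbol{\mathcal{T}}^{(j)}\|_F-\|\boldsymbol{\mathcal{T}}^{(j-1)}\|_F\le10^{-10}\|\boldsymbol{\mathcal{T}}^{(j)}\|_F$; compute $\Delta\varepsilon^{\mathrm n}_k$, $\Delta\varepsilon^{\mathrm a}_k$, $\overline{\varepsilon}^{\mathrm a,\tau}_k$, $\overline{\varepsilon}^{\mathrm n,\tau}_k$; until $\Delta\varepsilon^{\mathrm a}_k\le\overline{\varepsilon}^{\mathrm a,\tau}_k$ and $\Delta\varepsilon^{\mathrm n}_k\le\overline{\varepsilon}^{\mathrm n,\tau}_k$. 3. $\widehat{\mathcal{P}}^{\mathcal{U}}_\infty(t_{k+1})\leftarrow\widehat{\mathcal{P}}^{\mathcal{U}}_\infty(t_k)\oplus\operatorname{box}(e^{At_k}\widehat{\mathcal{P}}^{\mathcal{U}}_\infty(\Delta t_k))$ and $\widehat{\mathcal{P}}^{\mathcal{U}}_0(t_{k+1})\leftarrow\widehat{\mathcal{P}}^{\mathcal{U}}_0(t_k)\oplus e^{At_k}\widehat{\mathcal{P}}^{\mathcal{U}}_0(\Delta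 t_k)$. 4. Set $\rho_k\leftarrow0$; repeat $\rho_k\leftarrow\rho_k+1$ and compute $\Delta\varepsilon^{\mathrm r}_k(\rho_k)$, until $\Delta\varepsilon^{\mathrm r}_k(\rho_k)\le\overline{\varepsilon}^{\mathrm r,\tau}_k$. Set $\widehat{\mathcal{P}}^{\mathcal{U}}(t_{k+1})\leftarrow\operatorname{reduce}(\widehat{\mathcal{P}}^{\mathcal{U}}_0(t_{k+1}),\rho_k)\oplus\widehat{\mathcal{P}}^{\mathcal{U}}_\infty(t_{k+1})$. 5. $\mathcal{P}^u(t_{k+1})\leftarrow\mathcal{P}^u(t_k)+e^{At_k}\mathcal{P}^u(\Delta t_k)$; $\mathcal{H}(t_{k+1})\leftarrow e^{At_{k+1}}\mathcal{X}^0+\mathcal{P}^u(t_{k+1})$; $\widehat{\mathcal{H}}(\tau_k)\leftarrow\operatorname{comb}(\mathcal{H}(t_k),\mathcal{H}(t_{k+1}))\oplus\mathcal{C}$, where $\operatorname{comb}(\langle c_1,G_1\rangle_Z,\langle c_2,G_2\rangle_Z)=\langle\frac12(c_1+c_2),[\frac12(c_1-c_2)\ \frac12(G_1+G_2)\ \frac12(G_1-G_2)]\rangle_Z$. 6. Update $\varepsilon^{\mathrm a}_{k+1},\varepsilon^{\mathrm r}_{k+1}$; $\widehat{\mathcal{R}}(\tau_k)\leftarrow\widehat{\mathcal{H}}(\tau_k)\oplus\widehat{\mathcal{P}}^{\mathcal{U}}(t_{k+1})$; $k\leftarrow k+1$. Return $\bigcup_{j=0}^{k-1}\widehat{\mathcal{R}}(\tau_j)$.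 *)

(* Defs.v *)
From HB Require Import structures.
From mathcomp Require Import all_boot all_order all_algebra.
From mathcomp Require Import all_classical all_reals all_analysis.

Set Implicit Arguments.
Unset Strict Implicit.
Unset Printing Implicit Defensive.

Import Order.TTheory GRing.Theory Num.Theory.
Import numFieldNormedType.Exports.

Local Open Scope classical_set_scope.
Local Open Scope ring_scope.

Section Matrices.
Context {R : realType}.

Definition absmx m n (M : 'M[R]_(m, n)) : 'M[R]_(m, n) :=
  map_mx (fun x => `|x|) M.

(* Entrywise limit, so that no dimension has to be a successor. *)
Definition mxseries m n (u : nat -> 'M[R]_(m, n)) : 'M[R]_(m, n) :=
  \matrix_(i, j) lim (series (fun k => u k i j) @ \oo).

Definition expm n (M : 'M[R]_n) : 'M[R]_n :=
  mxseries (fun k => k`!%:R^-1 *: M ^+ k).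

Definition norm1 n (v : 'cV[R]_n) : R := \sum_i `|v i 0|.
Definition norm2 n (v : 'cV[R]_n) : R := Num.sqrt (\sum_i v i 0 ^+ 2).
Definition norminf n (v : 'cV[R]_n) : R := \big[Num.max/0]_i `|v i 0|.

Definition norm_frob m n (M : 'M[R]_(m, n)) : R :=
  Num.sqrt (\sum_i \sum_j M i j ^+ 2).

Definition norm_spec m n (M : 'M[R]_(m, n)) : R :=
  sup [set norm2 (M *m x) | x in [set x : 'cV[R]_n | norm2 x <= 1]].

End Matrices.

Section Sets.
Context {R : realType} {n : nat}.

Definition minkowski (S T : set 'cV[R]_n) : set 'cV[R]_n :=
  [set x + y | x in S & y in T].

Definition axis_box (l u : 'cV[R]_n) : set 'cV[R]_n :=
  [set x | forall i, l i 0 <= x i 0 <= u i 0].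

Definition box (S : set 'cV[R]_n) : set 'cV[R]_n :=
  [set x | forall l u, S `<=` axis_box l u -> axis_box l u x].

Definition rad (S : set 'cV[R]_n) : R :=
  inf [set r : R | 0 <= r /\ S `<=` [set x | norm2 x <= r]].

Definition err (S : set 'cV[R]_n) : R := rad (box S).

End Sets.

(* The generator matrix is stored as the list of its columns. *)
Record zonotope (R : realType) (n : nat) := Zonotope {
  zcenter : 'cV[R]_n;
  gens : seq 'cV[R]_n }.

Section Zonotopes.
Context {R : realType}.

Definition zset n (Z : zonotope R n) : set 'cV[R]_n :=
  [set x | exists a : nat -> R, (forall i, -1 <= a i <= 1) /\
     x = zcenter Z + \sum_(i < size (gens Z)) a i *: (gens Z)`_i].

Definition gens_mx n (Z : zonotope R n) : 'M[R]_(n, size (gens Z)) :=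
  \matrix_(i, j) (gens Z)`_j i 0.

Definition zvec n (v : 'cV[R]_n) : zonotope R n := Zonotope v [::].

Definition zmul m n (M : 'M[R]_(m, n)) (Z : zonotope R n) : zonotope R m :=
  Zonotope (M *m zcenter Z) [seq M *m g | g <- gens Z].

Definition zadd n (Z1 Z2 : zonotope R n) : zonotope R n :=
  Zonotope (zcenter Z1 + zcenter Z2) (gens Z1 ++ gens Z2).

(* The columns of the matrix diag(v). *)
Definition diag_gens n (v : 'cV[R]_n) : seq 'cV[R]_n :=
  [seq v i 0 *: delta_mx i 0 | i <- enum 'I_n].

(* Only meaningful when both arguments have the same number of generators. *)
Definition comb n (Z1 Z2 : zonotope R n) : zonotope R n :=
  Zonotope (2^-1 *: (zcenter Z1 + zcenter Z2))
    (2^-1 *: (zcenter Z1 - zcenter Z2)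
     :: [seq 2^-1 *: (g.1 + g.2) | g <- zip (gens Z1) (gens Z2)]
     ++ [seq 2^-1 *: (g.1 - g.2) | g <- zip (gens Z1) (gens Z2)]).

End Zonotopes.

(* (lower bound, upper bound).  Addition of pairs is componentwise, hence it is
   the addition of interval arithmetic and \sum can be used directly. *)
Definition interval_mx (R : realType) (m n : nat) : Type :=
  ('M[R]_(m, n) * 'M[R]_(m, n))%type.

Section IntervalMatrices.
Context {R : realType}.

Definition imem m n (I : interval_mx R m n) : set 'M[R]_(m, n) :=
  [set M | forall i j, I.1 i j <= M i j <= I.2 i j].

(* Interval arithmetic product of the real interval [a.1, a.2] and M. *)
Definition itv_mulmx m n (a : R * R) (M : 'M[R]_(m, n)) : interval_mx R m n :=
  (\matrix_(i, j) Num.min (a.1 * M i j) (a.2 * M i j),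
   \matrix_(i, j) Num.max (a.1 * M i j) (a.2 * M i j)).

Definition iscale m n (a : R) (I : interval_mx R m n) : interval_mx R m n :=
  (\matrix_(i, j) Num.min (a * I.1 i j) (a * I.2 i j),
   \matrix_(i, j) Num.max (a * I.1 i j) (a * I.2 i j)).

Definition icenter m n (I : interval_mx R m n) : 'M[R]_(m, n) :=
  2^-1 *: (I.1 + I.2).
Definition iradius m n (I : interval_mx R m n) : 'M[R]_(m, n) :=
  2^-1 *: (I.2 - I.1).

Definition inorm_frob m n (I : interval_mx R m n) : R :=
  sup [set norm_frob M | M in imem I].

Definition imulz m n (I : interval_mx R m n) (Z : zonotope R n) :
    zonotope R m :=
  Zonotope (icenter I *m zcenter Z)
    ([seq icenter I *m g | g <- gens Z]
     ++ diag_gens (iradius I *m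
          (absmx (zcenter Z) + \sum_(g <- gens Z) absmx g))).

End IntervalMatrices.

Section OrderReduction.
Context {R : realType} {n : nat}.

(* An arbitrary sorting procedure: ties may be broken in any way. *)
Definition sorts_generators (srt : seq 'cV[R]_n -> seq 'cV[R]_n) : Prop :=
  forall s, perm_eq (srt s) s /\
    sorted (fun g h => norm1 g - norminf g <= norm1 h - norminf h) (srt s).

Variable srt : seq 'cV[R]_n -> seq 'cV[R]_n.

Definition num_reduced (Z : zonotope R n) (rho : R) : int :=
  (size (gens Z))%:Z - Num.floor ((rho - 1) * n%:R).

Definition gens_keep (Z : zonotope R n) (rho : R) : seq 'cV[R]_n :=
  let chi := num_reduced Z rho in
  if chi <= 0 then gens Z else drop `|chi|%N (srt (gens Z)).

Definition gens_red (Z : zonotope R n) (rho : R) : seq 'cV[R]_n :=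
  let chi := num_reduced Z rho in
  if chi <= 0 then [::]
  else diag_gens (\sum_(g <- take `|chi|%N (srt (gens Z))) absmx g).

Definition reduce (Z : zonotope R n) (rho : R) : zonotope R n :=
  Zonotope (zcenter Z) (gens_keep Z rho ++ gens_red Z rho).

End OrderReduction.

Section AuxiliaryQuantities.
Context {R : realType} {n : nat}.
Variable A : 'M[R]_n.

Definition exp_rem (dt : R) (eta : nat) : 'M[R]_n :=
  expm (dt *: absmx A)
  - \sum_(0 <= i < eta.+1) i`!%:R^-1 *: (dt *: absmx A) ^+ i.

Definition iE (dt : R) (eta : nat) : interval_mx R n n :=
  (- exp_rem dt eta, exp_rem dt eta).

Definition itvI (i : nat) (dt : R) : R * R :=
  ((i%:R `^ (- (i%:R / (i%:R - 1))) - i%:R `^ (- (1 / (i%:R - 1))))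
     * dt ^+ i, 0).

Definition iF (dt : R) (eta : nat) : interval_mx R n n :=
  \sum_(2 <= i < eta.+1) itv_mulmx (itvI i dt) (i`!%:R^-1 *: A ^+ i)
  + iE dt eta.

Definition iG (dt : R) (eta : nat) : interval_mx R n n :=
  \sum_(2 <= i < eta.+2) itv_mulmx (itvI i dt) (i`!%:R^-1 *: A ^+ i.-1)
  + iscale dt (iE dt eta).

Definition iT (dt : R) (j : nat) : interval_mx R n n :=
  \sum_(2 <= i < j.+1) itv_mulmx (itvI i dt) (i`!%:R^-1 *: A ^+ i).

Definition eta_found (dt : R) (j : nat) : bool :=
  inorm_frob (iT dt j) - inorm_frob (iT dt j.-1)
    <= 10%:R ^- 10 * inorm_frob (iT dt j).

Definition Atilde (dt : R) (i : nat) : 'M[R]_n :=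
  (dt ^+ i.+1 / i.+1`!%:R) *: A ^+ i.

Definition Pu_step (utilde : 'cV[R]_n) (dt : R) : 'cV[R]_n :=
  if A \in unitmx then invmx A *m (expm (dt *: A) - 1%:M) *m utilde
  else mxseries (fun i => Atilde dt i *m utilde).

Variable U0 : zonotope R n.

Definition PU0_step (dt : R) : zonotope R n := zmul dt%:M U0.

Definition PUinf_step (dt : R) (eta : nat) : zonotope R n :=
  zadd (\big[@zadd R n/zvec 0]_(1 <= i < eta.+1) zmul (Atilde dt i) U0)
       (imulz (iscale dt (iE dt eta)) U0).

Definition PU_step (dt : R) (eta : nat) : zonotope R n :=
  zadd (PU0_step dt) (PUinf_step dt eta).

End AuxiliaryQuantities.

(* The system x' = A x + B u + p with initial set X0 and input set U,
   together with the parameters of the algorithm. *)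
Record reach_input (R : realType) (n m : nat) := ReachInput {
  sysA : 'M[R]_n;
  sysB : 'M[R]_(n, m);
  sysp : 'cV[R]_n;
  initX : zonotope R n;
  inputU : zonotope R m;
  tend : R;
  zeta : R;
  emax : R }.

(* The values of the variables at step k; [dt] is the step size, [PUinf] is kept
   as a set because it is a sum of tightest boxes, and [out] is the union of
   the sets computed in the previous steps. *)
Record vars (R : realType) (n : nat) := Vars {
  tk : R;
  dt : R;
  homog : zonotope R n;
  Pu : 'cV[R]_n;
  PU0 : zonotope R n;
  PUinf : set 'cV[R]_n;
  erra : R;
  errr : R;
  out : set 'cV[R]_n }.

(* Control points:
   [While]        about to test the condition of the main loop;
   [Halve]        at the head of the loop choosing the step size;
   [FindEta j]    about to test the truncation order j;
   [TestStep eta] about to evaluate the exit condition of the step size loop;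
   [FindRho eta rho] at the head of the loop choosing the reduction order,
                  where rho is the last order that was tried (0 if none). *)
Inductive control :=
  | While | Halve | FindEta of nat | TestStep of nat | FindRho of nat & nat
  | Done.

Section Algorithm.
Context {R : realType} {n m : nat}.
Variable inp : reach_input R n m.
Variable srt : seq 'cV[R]_n -> seq 'cV[R]_n.

Let A := sysA inp.

Definition input_offset : 'cV[R]_n := sysB inp *m zcenter (inputU inp) + sysp inp.

Definition input_zono : zonotope R n :=
  Zonotope 0 [seq sysB inp *m g | g <- gens (inputU inp)].

Let U0 := input_zono.

Definition setC_step (s : vars R n) (eta : nat) : zonotope R n :=
  zadd (imulz (iF A (dt s) eta) (homog s))
       (imulz (iG A (dt s) eta) (zvec input_offset)).

Definition derr_h (s : vars R n) (eta : nat) : R :=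
  2 * err (zset (setC_step s eta))
  + Num.sqrt (size (gens (homog s)))%:R
    * norm_spec ((expm (dt s *: A) - 1%:M) *m gens_mx (homog s)).

Definition derr_Utau (s : vars R n) (eta : nat) : R :=
  err (zset (zmul (expm (tk s *: A)) (PU_step A U0 (dt s) eta))).

Definition derr_n (s : vars R n) (eta : nat) : R :=
  derr_h s eta + derr_Utau s eta.

Definition derr_a (s : vars R n) (eta : nat) : R :=
  err (zset (zmul (expm (tk s *: A))
    (zadd (zmul (\sum_(1 <= i < eta.+1) Atilde A (dt s) i) U0)
          (imulz (iscale (dt s) (iE A (dt s) eta)) U0))))
  + err (zset (zmul (expm (tk s *: A)) (PUinf_step A U0 (dt s) eta))).

Definition next_PU0 (s : vars R n) : zonotope R n :=
  zadd (PU0 s) (zmul (expm (tk s *: A)) (PU0_step U0 (dt s))).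

Definition next_PUinf (s : vars R n) (eta : nat) : set 'cV[R]_n :=
  minkowski (PUinf s)
    (box (zset (zmul (expm (tk s *: A)) (PUinf_step A U0 (dt s) eta)))).

Definition derr_r (s : vars R n) (rho : nat) : R :=
  err (zset (Zonotope 0 (gens_red srt (next_PU0 s) rho%:R))).

Definition bound_r (t : R) : R := t / tend inp * zeta inp * emax inp.
Definition bound_a (t : R) : R := t / tend inp * (1 - zeta inp) * emax inp.

Definition step_bound_r (s : vars R n) : R := bound_r (tk s + dt s) - errr s.
Definition step_bound_a (s : vars R n) : R := bound_a (tk s + dt s) - erra s.
Definition step_bound_n (s : vars R n) : R :=
  emax inp - bound_r (tk s + dt s) - erra s.

Definition with_dt (s : vars R n) (d : R) : vars R n :=
  Vars (tk s) d (homog s) (Pu s) (PU0 s) (PUinf s) (erra s) (errr s) (out s).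

Definition next_vars (s : vars R n) (eta rho : nat) : vars R n :=
  let t' := tk s + dt s in
  let Pu' := Pu s + expm (tk s *: A) *m Pu_step A input_offset (dt s) in
  let homog' := zadd (zmul (expm (t' *: A)) (initX inp)) (zvec Pu') in
  let Rhom := zadd (comb (homog s) homog') (setC_step s eta) in
  let PU' := minkowski (zset (reduce srt (next_PU0 s) rho%:R))
                       (next_PUinf s eta) in
  Vars t' (dt s) homog' Pu' (next_PU0 s) (next_PUinf s eta)
    (erra s + derr_a s eta) (errr s + derr_r s rho)
    (out s `|` minkowski (zset Rhom) PU').

Definition init : control * vars R n :=
  (While, Vars 0 (tend inp) (initX inp) 0 (zvec 0) [set 0] 0 0 set0).

Definition step (c : control * vars R n) : control * vars R n :=
  let s := c.2 in
  match c.1 with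
  | While =>
      if tk s < tend inp then (Halve, with_dt s (2 * dt s)) else (Done, s)
  | Halve => (FindEta 2, with_dt s (2^-1 * dt s))
  | FindEta j =>
      if eta_found A (dt s) j then (TestStep j, s) else (FindEta j.+1, s)
  | TestStep eta =>
      if (derr_a s eta <= step_bound_a s) && (derr_n s eta <= step_bound_n s)
      then (FindRho eta 0, s) else (Halve, s)
  | FindRho eta rho =>
      if derr_r s rho.+1 <= step_bound_r s
      then (While, next_vars s eta rho.+1) else (FindRho eta rho.+1, s)
  | Done => c
  end.

(* Every elementary step performs at most one iteration of one of the loops, so
   reaching [Done] means that every loop is run finitely many times. *)
Definition terminates : Prop := exists N, (iter N step init).1 = Done.

End Algorithm.

(* Main.v *)
Require Import Defs.
From mathcomp Require Import all_boot all_order all_algebra.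
From mathcomp Require Import all_classical all_reals all_analysis.
From mathcomp Require Import ring lra.

(** The algorithm can only fail to stop by running one of its loops forever.

    The main loop. Step sizes only ever get halved, so they are [tend / 2 ^+ q]
    for some [q], and the remaining time is always a multiple of the current
    one. If the indices [q] stay bounded, the remaining time in units of the
    finest step size in use is a natural number that decreases at each step.
    What has to be excluded is that steps become shorter and shorter, as in
    Zeno's paradox. This is a real danger, because the admissible
    non-accumulating error can shrink with the remaining time. Three facts
    exclude it.

    - Uniformly in the step and in the truncation order, the accumulating error
      of a step of size [dt] is at most [K * dt ^+ 2] ([derr_a_le]) and the
      non-accumulating one at most [K * dt] ([derr_n_le]). The uniformity rests
      on the bounds on exponential tails ([exp_coeff_tail], [mxseries_tail]) and
      on the invariant that the homogeneous solution remains bounded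
      ([invariant_next]).
    - The admissible accumulating error grows linearly in time, at the rate
      [budget_rate > 0]. A step with [K * dt <= budget_rate / 2] uses at most
      half of what it earns, and leaves an unused part, the slack. Steps with
      [K * dt <= budget_rate] never decrease the slack.
    - The admissible non-accumulating error is at least the slack
      ([step_test_passes]). So once there is slack [delta], every step size with
      [K * dt <= delta] passes, and the step sizes are bounded below
      ([halts_with_slack]).

    Hence either no step is shorter than a fixed threshold, or the first shorter
    one creates slack, after which the indices are bounded ([halts_on_grid]).
    In a single step the halving stops since the remaining time is positive.

    The inner loops. The norms compared in the search for the truncation order
    are bounded, while an endless search would make them grow by a fixed amount
    each time ([eta_found_exists]). For a large reduction order nothing is
    reduced ([derr_r_eventually0]), and the error [0] is admissible because the
    bound on the reduction error is nondecreasing in time.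

    All estimates use the sum [mnorm] of the absolute values of the entries: it
    is submultiplicative, it dominates the Frobenius and the spectral norm, and
    summed over center and generators it dominates [err] ([err_zset_le]). *)

Set Implicit Arguments.
Unset Strict Implicit.
Unset Printing Implicit Defensive.

Import Order.TTheory GRing.Theory Num.Theory.
Import numFieldNormedType.Exports.

Local Open Scope classical_set_scope.
Local Open Scope ring_scope.

(** * The sum of the absolute values of the entries of a matrix *)

Section EntrywiseNorm.
Context {R : realType}.

Definition mnorm m n (M : 'M[R]_(m, n)) : R := \sum_i \sum_j `|M i j|.

Lemma mnorm_ge0 m n (M : 'M[R]_(m, n)) : 0 <= mnorm M.
Proof. by apply: sumr_ge0 => i _; apply: sumr_ge0 => j _. Qed.

Lemma mnorm0 m n : mnorm (0 : 'M[R]_(m, n)) = 0.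
Proof.
by rewrite /mnorm big1 // => i _; rewrite big1 // => j _; rewrite mxE normr0.
Qed.

Lemma mnorm1 n : mnorm (1%:M : 'M[R]_n) = n%:R.
Proof.
rewrite /mnorm (eq_bigr (fun=> 1)) ?sumr_const ?card_ord // => i _.
rewrite (bigD1 i) //= big1 => [|j ji]; first by rewrite mxE eqxx normr1 addr0.
by rewrite mxE eq_sym (negPf ji) normr0.
Qed.

Lemma mnorm_ge_entry m n (M : 'M[R]_(m, n)) i j : `|M i j| <= mnorm M.
Proof.
rewrite /mnorm (bigD1 i) //= (bigD1 j) //= -addrA lerDl addr_ge0 //.
  exact: sumr_ge0.
by apply: sumr_ge0 => k _; apply: sumr_ge0.
Qed.

(** Minima and maxima of two numbers are bounded by the sum of the absolute
    values, so interval arithmetic only ever needs this form of monotonicity. *)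
Lemma mnorm_le2 m n (M N P : 'M[R]_(m, n)) :
  (forall i j, `|M i j| <= `|N i j| + `|P i j|) ->
  mnorm M <= mnorm N + mnorm P.
Proof.
move=> le_M; rewrite /mnorm -big_split; apply: ler_sum => i _ /=.
by rewrite -big_split; apply: ler_sum.
Qed.

Lemma mnormD m n (M N : 'M[R]_(m, n)) : mnorm (M + N) <= mnorm M + mnorm N.
Proof. by apply: mnorm_le2 => i j; rewrite mxE ler_normD. Qed.

Lemma mnormN m n (M : 'M[R]_(m, n)) : mnorm (- M) = mnorm M.
Proof. by apply: eq_bigr => i _; apply: eq_bigr => j _; rewrite mxE normrN. Qed.

Lemma mnorm_abs m n (M : 'M[R]_(m, n)) : mnorm (absmx M) = mnorm M.
Proof.
by apply: eq_bigr => i _; apply: eq_bigr => j _; rewrite mxE normr_id.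
Qed.

Lemma mnormZ m n a (M : 'M[R]_(m, n)) : mnorm (a *: M) = `|a| * mnorm M.
Proof.
rewrite /mnorm mulr_sumr; apply: eq_bigr => i _.
by rewrite mulr_sumr; apply: eq_bigr => j _; rewrite mxE normrM.
Qed.

Lemma mnorm_sum m n I (r : seq I) (P : pred I) (F : I -> 'M[R]_(m, n)) :
  mnorm (\sum_(i <- r | P i) F i) <= \sum_(i <- r | P i) mnorm (F i).
Proof.
elim/big_rec2: _ => [|i y x _ le_xy]; first by rewrite mnorm0.
by rewrite (le_trans (mnormD _ _)) // lerD2l.
Qed.

Lemma mnormM m n p (M : 'M[R]_(m, n)) (N : 'M[R]_(n, p)) :
  mnorm (M *m N) <= mnorm M * mnorm N.
Proof.
rewrite /mnorm mulr_suml; apply: ler_sum => i _.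
apply: (@le_trans _ _ (\sum_j \sum_k `|M i k| * `|N k j|)).
  apply: ler_sum => j _; rewrite mxE (le_trans (ler_norm_sum _ _ _)) //.
  by apply: ler_sum => k _; rewrite normrM.
rewrite exchange_big /= mulr_suml; apply: ler_sum => k _.
rewrite -mulr_sumr; apply: ler_wpM2l => //.
rewrite [leRHS](bigD1 k) //= lerDl.
by apply: sumr_ge0 => l _; apply: sumr_ge0.
Qed.

(** The factor [n] is the norm of the identity matrix, the case [k = 0]. *)
Lemma mnormX n (M : 'M[R]_n) k : mnorm (M ^+ k) <= n%:R * mnorm M ^+ k.
Proof.
elim: k => [|k IHk]; first by rewrite !expr0 mulr1 mnorm1.
rewrite !exprS (le_trans (mnormM _ _)) // mulrCA.
by rewrite ler_wpM2l ?mnorm_ge0.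
Qed.

End EntrywiseNorm.

(** * Tails of matrix exponential series *)

Section ExponentialSeries.
Context {R : realType}.
Implicit Types x c : R.

(** The factorial of [i + q] is at least that of [i]. *)
Lemma exp_coeff_shift x q i : 0 <= x ->
  exp_coeff x (i + q)%N <= x ^+ q * exp_coeff x i.
Proof.
move=> x0; rewrite /exp_coeff /= exprD -mulrA mulrCA.
rewrite 2?ler_wpM2l ?exprn_ge0 // lef_pV2 ?posrE ?ltr0n ?fact_gt0 //.
by rewrite ler_nat leq_fact ?leq_addr.
Qed.

(** Pulling out only [x ^+ q], for some [q <= p], keeps the bound free of the
    number of omitted terms: the truncation order changes from step to step,
    while the error estimates must not depend on it. *)
Lemma exp_coeff_tail x q p m : 0 <= x -> (q <= p)%N ->
  \sum_(p <= i < m) exp_coeff x i <= x ^+ q * expR x.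
Proof.
move=> x0 qp.
have cge0 i : 0 <= exp_coeff x i by exact: exp_coeff_ge0.
have [pm|mp] := leqP p m; last first.
  by rewrite big_geq ?(ltnW mp) // mulr_ge0 ?exprn_ge0 ?expR_ge0.
apply: (@le_trans _ _ (\sum_(q <= i < m) exp_coeff x i)).
  by rewrite [leRHS](big_cat_nat qp pm) //= lerDr sumr_ge0.
rewrite -[q in leLHS]add0n big_addn.
apply: (@le_trans _ _ (\sum_(0 <= i < m - q) x ^+ q * exp_coeff x i)).
  by apply: ler_sum => i _; exact: exp_coeff_shift.
rewrite -mulr_sumr ler_wpM2l ?exprn_ge0 //.
apply: (@nondecreasing_cvgn_le _ (series (exp_coeff x))).
  by apply: nondecreasing_series.
exact: is_cvg_series_exp_coeff.
Qed.

(** The entries of the series converge absolutely by comparison with the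
    exponential series; the partial sums obey the bound by [exp_coeff_tail], and
    it passes to the limit because [mnorm] is a finite sum of continuous
    functions of the entries. *)
Lemma mxseries_tail m n (u : nat -> 'M[R]_(m, n)) c x q p :
  0 <= c -> 0 <= x -> (q <= p)%N ->
  (forall k, mnorm (u k) <= c * exp_coeff x k) ->
  mnorm (mxseries u - \sum_(0 <= k < p) u k) <= c * (x ^+ q * expR x).
Proof.
move=> c0 x0 qp ule.
have cvgu i j : cvgn (series (fun k => u k i j)).
  apply: normed_cvg; apply: (@series_le_cvg _ _ (c *: exp_coeff x)).
  - by move=> k; exact: normr_ge0.
  - by move=> k; apply: mulr_ge0 => //; exact: exp_coeff_ge0.
  - by move=> k; apply: le_trans (ule k); exact: mnorm_ge_entry.
  - by apply: is_cvg_seriesZ; exact: is_cvg_series_exp_coeff.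
pose f k := mnorm (\sum_(0 <= l < k) u l - \sum_(0 <= l < p) u l).
have cvgf : f k @[k --> \oo] --> mnorm (mxseries u - \sum_(0 <= l < p) u l).
  apply: cvg_big => [|i _]; first exact: add_continuous.
  apply: cvg_big => [|j _]; first exact: add_continuous.
  rewrite !mxE; under eq_cvg do rewrite !mxE.
  apply: cvg_norm; apply: cvgB; last exact: cvg_cst.
  under eq_cvg do rewrite summxE.
  exact: cvgu.
rewrite -(cvg_lim _ cvgf) //; apply: limr_le.
  by apply/cvg_ex; exists (mnorm (mxseries u - \sum_(0 <= l < p) u l)).
near=> k; have pk : (p <= k)%N by near: k; exact: nbhs_infty_ge.
rewrite /f (big_cat_nat (leq0n p) pk) //= addrAC subrr add0r.
rewrite (le_trans (mnorm_sum _ _ _)) //.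
apply: (@le_trans _ _ (\sum_(p <= l < k) c * exp_coeff x l)).
  exact: ler_sum.
by rewrite -mulr_sumr ler_wpM2l // exp_coeff_tail.
Unshelve. all: by end_near. Qed.

Lemma mnorm_exp_term n (M : 'M[R]_n) k :
  mnorm (k`!%:R^-1 *: M ^+ k) <= n%:R * exp_coeff (mnorm M) k.
Proof.
rewrite mnormZ ger0_norm // /exp_coeff /= mulrA mulrC.
by rewrite ler_wpM2r // mnormX.
Qed.

Lemma expm_tail n (M : 'M[R]_n) q p : (q <= p)%N ->
  mnorm (expm M - \sum_(0 <= k < p) k`!%:R^-1 *: M ^+ k)
    <= n%:R * (mnorm M ^+ q * expR (mnorm M)).
Proof.
move=> qp; apply: mxseries_tail => //; first exact: mnorm_ge0.
by move=> k; exact: mnorm_exp_term.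
Qed.

Lemma mnorm_expm n (M : 'M[R]_n) : mnorm (expm M) <= n%:R * expR (mnorm M).
Proof.
by have := @expm_tail n M 0 0 (leqnn _); rewrite big_geq // subr0 expr0 mul1r.
Qed.

Lemma mnorm_expmB1 n (M : 'M[R]_n) :
  mnorm (expm M - 1%:M) <= n%:R * (mnorm M * expR (mnorm M)).
Proof.
have := @expm_tail n M 1 1 (leqnn _).
by rewrite big_nat1 expr0 fact0 invr1 scale1r expr1.
Qed.

End ExponentialSeries.

(** * Bounds on the norms, zonotope errors and interval products *)

Section Norms.
Context {R : realType}.

(** The Euclidean norm is at most the sum of absolute values; applied to each
    row and then to the row sums it compares the Frobenius norm with [mnorm]. *)
Lemma sum_sqr_le I (r : seq I) (a : I -> R) :
  \sum_(i <- r) a i ^+ 2 <= (\sum_(i <- r) `|a i|) ^+ 2.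
Proof.
elim: r => [|i r IHr]; first by rewrite !big_nil expr0n.
rewrite !big_cons sqrrD real_normK ?num_real // -addrA lerD2l.
by rewrite (le_trans IHr) // lerDr mulrn_wge0 // mulr_ge0 ?sumr_ge0.
Qed.

Lemma norm_frob_le m n (M : 'M[R]_(m, n)) : norm_frob M <= mnorm M.
Proof.
rewrite -[leRHS]ger0_norm ?mnorm_ge0 // -sqrtr_sqr ler_sqrt ?sqr_ge0 //.
apply: (@le_trans _ _ (\sum_i (\sum_j `|M i j|) ^+ 2)).
  by apply: ler_sum => i _; exact: sum_sqr_le.
apply: le_trans (sum_sqr_le _ _) _; rewrite le_eqVlt; apply/predU1P; left.
congr (_ ^+ 2); apply: eq_bigr => i _.
by rewrite ger0_norm // sumr_ge0.
Qed.

Lemma norm2_frob n (v : 'cV[R]_n) : norm2 v = norm_frob v.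
Proof.
by congr Num.sqrt; apply: eq_bigr => i _; rewrite big_ord_recl big_ord0 addr0.
Qed.

Lemma norm_frob_ge0 m n (M : 'M[R]_(m, n)) : 0 <= norm_frob M.
Proof. exact: sqrtr_ge0. Qed.

Lemma entry_le_norm_frob m n (M : 'M[R]_(m, n)) i j : `|M i j| <= norm_frob M.
Proof.
rewrite -sqrtr_sqr ler_sqrt; last first.
  by do 2![apply: sumr_ge0 => ? _]; exact: sqr_ge0.
rewrite (bigD1 i) //= (bigD1 j) //= -addrA lerDl addr_ge0 //.
  by apply: sumr_ge0 => ? _; exact: sqr_ge0.
by do 2![apply: sumr_ge0 => ? _]; exact: sqr_ge0.
Qed.

(** Vectors in the unit ball have entries of absolute value at most one. *)
Lemma norm_spec_le m n (M : 'M[R]_(m, n)) : norm_spec M <= mnorm M.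
Proof.
apply: ge_sup.
  exists (norm2 (M *m 0)); exists 0 => //=.
  by rewrite norm2_frob (le_trans (norm_frob_le _)) ?mnorm0.
move=> _ [x /= x1 <-]; rewrite norm2_frob (le_trans (norm_frob_le _)) //.
apply: ler_sum => i _; rewrite big_ord_recl big_ord0 addr0 mxE.
apply: le_trans (ler_norm_sum _ _ _) _; apply: ler_sum => j _.
rewrite normrM ler_piMr // (le_trans (entry_le_norm_frob _ _ _)) //.
by rewrite -norm2_frob.
Qed.

(** A bound on the radius of the zonotope that is subadditive for Minkowski sums
    and unchanged when generators are replaced by their box. *)
Definition znorm n (Z : zonotope R n) : R :=
  mnorm (zcenter Z) + \sum_(g <- gens Z) mnorm g.

Lemma znorm_ge0 n (Z : zonotope R n) : 0 <= znorm Z.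
Proof.
rewrite addr_ge0 ?mnorm_ge0 //.
by apply: sumr_ge0 => g _; exact: mnorm_ge0.
Qed.

Lemma znorm_vec n (v : 'cV[R]_n) : znorm (zvec v) = mnorm v.
Proof. by rewrite /znorm big_nil addr0. Qed.

Lemma znormD n (Z1 Z2 : zonotope R n) :
  znorm (zadd Z1 Z2) <= znorm Z1 + znorm Z2.
Proof. by rewrite /znorm big_cat /= addrACA lerD2r mnormD. Qed.

Lemma znormM m n (M : 'M[R]_(m, n)) (Z : zonotope R n) :
  znorm (zmul M Z) <= mnorm M * znorm Z.
Proof.
rewrite /znorm big_map mulrDr lerD ?mnormM // mulr_sumr.
by apply: ler_sum => g _; exact: mnormM.
Qed.

Lemma znorm_zsum n I (r : seq I) (P : pred I) (F : I -> zonotope R n) :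
  znorm (\big[@zadd R n/zvec 0]_(i <- r | P i) F i)
    <= \sum_(i <- r | P i) znorm (F i).
Proof.
elim/big_rec2: _ => [|i y x _ le_xy]; first by rewrite znorm_vec mnorm0.
by rewrite (le_trans (znormD _ _)) // lerD2l.
Qed.

Lemma sum_diag_gens n (v : 'cV[R]_n) :
  \sum_(g <- diag_gens v) mnorm g = mnorm v.
Proof.
rewrite big_map big_enum /=; apply: eq_bigr => i _.
rewrite big_ord_recl big_ord0 addr0 mnormZ /mnorm.
rewrite (bigD1 i) //= [X in _ + X]big1.
  by rewrite big_ord_recl big_ord0 !addr0 mxE !eqxx normr1 mulr1.
by move=> k ki; rewrite big1 // => j _; rewrite mxE (negPf ki) normr0.
Qed.

(** The zonotope lies in the box centered at the origin with half widths
    [|c| + sum |g|]; the tightest box is then contained in it as well, and the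
    Euclidean norm of its points is at most the sum of these half widths. *)
Lemma err_zset_le n (Z : zonotope R n) : err (zset Z) <= znorm Z.
Proof.
pose l := absmx (zcenter Z) + \sum_(g <- gens Z) absmx g.
have lE i : l i 0 = `|zcenter Z i 0| + \sum_(g <- gens Z) `|g i 0|.
  rewrite !mxE summxE; congr (_ + _).
  by apply: eq_bigr => g _; rewrite mxE.
have Zl : zset Z `<=` axis_box (- l) l.
  move=> _ [a [a1 ->]] i; rewrite [(- l) i 0]mxE -ler_norml lE mxE.
  apply: le_trans (ler_normD _ _) _; rewrite lerD2l.
  rewrite summxE (big_nth 0) big_mkord (le_trans (ler_norm_sum _ _ _)) //.
  by apply: ler_sum => j _; rewrite mxE normrM ler_piMl // ler_norml a1.
have l_le : mnorm l <= znorm Z.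
  rewrite (le_trans (mnormD _ _)) // mnorm_abs lerD2l.
  rewrite (le_trans (mnorm_sum _ _ _)) //.
  by apply: ler_sum => g _; rewrite mnorm_abs.
apply: ge_inf; first by exists 0 => r [].
split; first exact: znorm_ge0.
move=> x /(_ _ _ Zl) xl /=; rewrite norm2_frob.
apply: le_trans (norm_frob_le _) _; apply: le_trans l_le.
apply: ler_sum => i _; apply: ler_sum => j _; rewrite (ord1 j).
have := xl i; rewrite [(- l) i 0]mxE -ler_norml => /le_trans; apply.
exact: ler_norm.
Qed.

Definition inorm m n (I : interval_mx R m n) : R := mnorm I.1 + mnorm I.2.

Lemma inorm_ge0 m n (I : interval_mx R m n) : 0 <= inorm I.
Proof. by rewrite addr_ge0 ?mnorm_ge0. Qed.

Lemma inormD m n (I J : interval_mx R m n) : inorm (I + J) <= inorm I + inorm J.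
Proof. by rewrite /inorm addrACA lerD ?mnormD. Qed.

Lemma inorm_sum m n I (r : seq I) (P : pred I) (F : I -> interval_mx R m n) :
  inorm (\sum_(i <- r | P i) F i) <= \sum_(i <- r | P i) inorm (F i).
Proof.
elim/big_rec2: _ => [|i y x _ le_xy]; first by rewrite /inorm !mnorm0 addr0.
by rewrite (le_trans (inormD _ _)) // lerD2l.
Qed.

Lemma normr_min_le (x y : R) : `|Num.min x y| <= `|x| + `|y|.
Proof. by rewrite /Num.min; case: ifP; rewrite ?lerDl ?lerDr. Qed.

Lemma normr_max_le (x y : R) : `|Num.max x y| <= `|x| + `|y|.
Proof. by rewrite /Num.max; case: ifP; rewrite ?lerDl ?lerDr. Qed.

Lemma inorm_scale m n a (I : interval_mx R m n) :
  inorm (iscale a I) <= 2 * (`|a| * inorm I).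
Proof.
rewrite mulr2n mulrDl mul1r lerD // /inorm mulrDr -!mnormZ.
  by apply: mnorm_le2 => i j; rewrite !mxE normr_min_le.
by apply: mnorm_le2 => i j; rewrite !mxE normr_max_le.
Qed.

Lemma inorm_itv_mulmx m n (a : R) (M : 'M[R]_(m, n)) :
  inorm (itv_mulmx (a, 0) M) <= 2 * (`|a| * mnorm M).
Proof.
rewrite mulr2n mulrDl mul1r -mnormZ.
rewrite lerD // -[leRHS]addr0 -[X in _ + X](@mnorm0 R m n).
  by apply: mnorm_le2 => i j; rewrite !mxE mul0r normr_min_le.
by apply: mnorm_le2 => i j; rewrite !mxE mul0r normr_max_le.
Qed.

(** The center and the radius of [I] have norm at most [inorm I / 2] each. *)
Lemma znorm_imulz m n (I : interval_mx R m n) (Z : zonotope R n) :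
  znorm (imulz I Z) <= inorm I * znorm Z.
Proof.
have half : `|2^-1 : R| = 2^-1 by rewrite ger0_norm.
have center_le : mnorm (icenter I) <= 2^-1 * inorm I.
  by rewrite mnormZ half ler_wpM2l // mnormD.
have radius_le : mnorm (iradius I) <= 2^-1 * inorm I.
  rewrite mnormZ half ler_wpM2l // (le_trans (mnormD _ _)) //.
  by rewrite mnormN addrC.
rewrite /znorm big_cat /= sum_diag_gens addrA.
rewrite (splitr (inorm I)) mulrDl ![inorm I / 2]mulrC lerD //.
  apply: le_trans (znormM (icenter I) Z) _ => //.
  by rewrite ler_wpM2r ?znorm_ge0.
apply: le_trans (mnormM _ _) _; apply: ler_pM; rewrite ?mnorm_ge0 //.
rewrite (le_trans (mnormD _ _)) // mnorm_abs lerD2l.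
rewrite (le_trans (mnorm_sum _ _ _)) //.
by apply: ler_sum => g _; rewrite mnorm_abs.
Qed.

Lemma imem_norm_frob_le m n (I : interval_mx R m n) M :
  imem I M -> norm_frob M <= inorm I.
Proof.
move=> IM; apply: le_trans (norm_frob_le _) _.
apply: mnorm_le2 => i j; have /andP[lo hi] := IM i j.
rewrite ler_norml; apply/andP; split.
  rewrite (le_trans _ lo) // lerNl (le_trans (ler_norm _)) // normrN.
  by rewrite lerDl.
by rewrite (le_trans hi) // (le_trans (ler_norm _)) // lerDr.
Qed.

(** The supremum of the empty set is [0], so the lower bound also holds for an
    interval matrix without elements. *)
Lemma inorm_frob_itv m n (I : interval_mx R m n) :
  0 <= inorm_frob I <= inorm I.
Proof.
rewrite /inorm_frob.
have [->|/set0P I0] := eqVneq [set norm_frob M | M in imem I] set0.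
  by rewrite sup0 lexx inorm_ge0.
have ubI : ubound [set norm_frob M | M in imem I] (inorm I).
  by move=> _ [M IM <-]; exact: imem_norm_frob_le.
rewrite (ge_sup I0 ubI) andbT; have [e Ie] := I0.
apply: (@le_trans _ _ e); first by case: Ie => M _ <-; exact: norm_frob_ge0.
by apply: ub_le_sup => //; exists (inorm I).
Qed.

End Norms.

(** * Sizes of the auxiliary quantities in the step size *)

Section StepBounds.
Context {R : realType} {n : nat}.
Variables (A : 'M[R]_n) (T : R).
Implicit Types (dt : R) (eta : nat) (U : zonotope R n).

(** Over the time horizon [T], this bounds [expm (t *: A)] and, up to a power of
    [t * mnorm A], the tails of its series, for all truncation orders. *)
Definition growth : R := n%:R * expR (T * mnorm A).

Lemma growth_ge0 : 0 <= growth.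
Proof. by rewrite mulr_ge0 ?expR_ge0. Qed.

Lemma growth_ge dt : 0 <= dt <= T -> n%:R * expR (dt * mnorm A) <= growth.
Proof.
move=> /andP[_ dtT]; rewrite ler_wpM2l // ler_expR ler_wpM2r //.
exact: mnorm_ge0.
Qed.

Lemma mnorm_expmA t : 0 <= t <= T -> mnorm (expm (t *: A)) <= growth.
Proof.
move=> tT; apply: le_trans (growth_ge tT); have /andP[t0 _] := tT.
by apply: le_trans (mnorm_expm _) _; rewrite mnormZ ger0_norm.
Qed.

Lemma mnorm_expmAB1 dt : 0 <= dt <= T ->
  mnorm (expm (dt *: A) - 1%:M) <= growth * (dt * mnorm A).
Proof.
move=> dtT; have /andP[dt0 _] := dtT.
apply: le_trans (mnorm_expmB1 _) _; rewrite mnormZ ger0_norm // mulrCA mulrC.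
by rewrite ler_wpM2r ?growth_ge // mulr_ge0 ?mnorm_ge0.
Qed.

Lemma sum_exp_coeff_le dt q p m : 0 <= dt <= T -> (q <= p)%N ->
  n%:R * \sum_(p <= i < m) exp_coeff (dt * mnorm A) i
    <= growth * (dt * mnorm A) ^+ q.
Proof.
move=> dtT qp; have /andP[dt0 _] := dtT.
have x0 : 0 <= dt * mnorm A by rewrite mulr_ge0 ?mnorm_ge0.
apply: (@le_trans _ _ (n%:R * ((dt * mnorm A) ^+ q * expR (dt * mnorm A)))).
  by rewrite ler_wpM2l // exp_coeff_tail.
by rewrite mulrCA mulrC ler_wpM2r ?exprn_ge0 ?growth_ge.
Qed.

Lemma mnorm_exp_rem dt eta q : 0 <= dt <= T -> (q <= eta.+1)%N ->
  mnorm (exp_rem A dt eta) <= growth * (dt * mnorm A) ^+ q.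
Proof.
move=> dtT qeta; have /andP[dt0 _] := dtT.
have x0 : 0 <= dt * mnorm A by rewrite mulr_ge0 ?mnorm_ge0.
apply: le_trans (expm_tail _ qeta) _.
rewrite !mnormZ mnorm_abs ger0_norm // mulrCA mulrC.
by rewrite ler_wpM2r ?exprn_ge0 ?growth_ge.
Qed.

Lemma inorm_iE dt eta q : 0 <= dt <= T -> (q <= eta.+1)%N ->
  inorm (iE A dt eta) <= 2 * (growth * (dt * mnorm A) ^+ q).
Proof.
move=> dtT qeta; rewrite /inorm /= mnormN mulr2n mulrDl mul1r.
by rewrite lerD // mnorm_exp_rem.
Qed.

(** Both powers of [i] have a nonpositive exponent, hence lie in [0, 1]. *)
Lemma norm_itvI i dt : (1 < i)%N -> 0 <= dt -> `|(itvI i dt).1| <= dt ^+ i.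
Proof.
move=> i1 dt0; rewrite /itvI /= normrM [X in _ * X]ger0_norm ?exprn_ge0 //.
rewrite ler_piMl ?exprn_ge0 //.
have i1R : 1 <= i%:R :> R by rewrite ler1n ltnW.
have iB1 : 0 <= i%:R - 1 :> R by rewrite subr_ge0.
have pow_itv (y : R) : y <= 0 -> 0 <= i%:R `^ y <= 1.
  move=> y0; rewrite powR_ge0 /=.
  by have := ler_powR i1R y0; rewrite powRr0.
have /andP[a0 a1] : 0 <= (i%:R : R) `^ (- (i%:R / (i%:R - 1))) <= 1.
  by apply: pow_itv; rewrite oppr_le0 divr_ge0.
have /andP[b0 b1] : 0 <= (i%:R : R) `^ (- (1 / (i%:R - 1))) <= 1.
  by apply: pow_itv; rewrite oppr_le0 divr_ge0.
rewrite ler_norml; apply/andP; split; lra.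
Qed.

Lemma inorm_itvI i dt (M : 'M[R]_n) : (1 < i)%N -> 0 <= dt ->
  inorm (itv_mulmx (itvI i dt) M) <= 2 * (dt ^+ i * mnorm M).
Proof.
move=> i1 dt0; apply: le_trans (inorm_itv_mulmx _ _) _.
by rewrite ler_wpM2l // ler_wpM2r ?mnorm_ge0 ?norm_itvI.
Qed.

Lemma mnorm_taylor_term dt i : 0 <= dt ->
  dt ^+ i * mnorm (i`!%:R^-1 *: A ^+ i) <= n%:R * exp_coeff (dt * mnorm A) i.
Proof.
move=> dt0; rewrite mnormZ ger0_norm // /exp_coeff /= exprMn.
have -> : n%:R * (dt ^+ i * mnorm A ^+ i / i`!%:R)
    = dt ^+ i * (i`!%:R^-1 * (n%:R * mnorm A ^+ i)) by ring.
by rewrite !ler_wpM2l ?exprn_ge0 ?mnormX.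
Qed.

Lemma inorm_iT dt j q : 0 <= dt <= T -> (q <= 2)%N ->
  inorm (iT A dt j) <= 2 * (growth * (dt * mnorm A) ^+ q).
Proof.
move=> dtT q2; have /andP[dt0 _] := dtT; apply: le_trans (inorm_sum _ _ _) _.
apply: (@le_trans _ _
  (\sum_(2 <= i < j.+1) 2 * (n%:R * exp_coeff (dt * mnorm A) i))).
  apply: ler_sum_nat => i /andP[i2 _].
  apply: le_trans (inorm_itvI _ i2 dt0) _.
  by rewrite ler_wpM2l // mnorm_taylor_term.
by rewrite -!mulr_sumr ler_wpM2l // sum_exp_coeff_le.
Qed.

(** For [eta >= 1] the interval matrix is even quadratic in [dt]; a linear bound
    is enough because it enters only the non-accumulating error. *)
Lemma inorm_iF dt eta : 0 <= dt <= T ->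
  inorm (iF A dt eta) <= 4 * (growth * (dt * mnorm A)).
Proof.
move=> dtT; apply: le_trans (inormD _ _) _.
have := @inorm_iT dt eta 1 dtT isT; have := @inorm_iE dt eta 1 dtT isT.
rewrite expr1; lra.
Qed.

Lemma inorm_scale_iE dt eta q : 0 <= dt <= T -> (q <= eta.+1)%N ->
  inorm (iscale dt (iE A dt eta)) <= 4 * (growth * (dt * mnorm A) ^+ q) * dt.
Proof.
move=> dtT qeta; have /andP[dt0 _] := dtT.
apply: le_trans (inorm_scale _ _) _; rewrite ger0_norm //.
apply: (@le_trans _ _ (2 * (dt * (2 * (growth * (dt * mnorm A) ^+ q))))).
  by rewrite !ler_wpM2l ?inorm_iE.
by rewrite le_eqVlt; apply/predU1P; left; ring.
Qed.

(** Shifting the index by one turns [dt ^+ i * A ^+ i.-1 / i!] into [dt] times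
    a term dominated by the exponential series. *)
Lemma inorm_iG dt eta : 0 <= dt <= T ->
  inorm (iG A dt eta) <= 6 * growth * dt.
Proof.
move=> dtT; have /andP[dt0 _] := dtT.
apply: le_trans (inormD _ _) _.
have := @inorm_scale_iE dt eta 0 dtT isT; rewrite expr0 mulr1.
suff : inorm (\sum_(2 <= i < eta.+2)
         itv_mulmx (itvI i dt) (i`!%:R^-1 *: A ^+ i.-1)) <= 2 * (dt * growth).
  by lra.
apply: le_trans (inorm_sum _ _ _) _; rewrite big_add1 /=.
apply: (@le_trans _ _
  (\sum_(1 <= i < eta.+1) 2 * (dt * (n%:R * exp_coeff (dt * mnorm A) i)))).
  apply: ler_sum_nat => i /andP[i1 _].
  apply: le_trans (@inorm_itvI i.+1 _ _ i1 dt0) _.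
  rewrite ler_wpM2l // exprS -mulrA ler_wpM2l //.
  apply: le_trans (mnorm_taylor_term _ dt0); rewrite ler_wpM2l ?exprn_ge0 //.
  rewrite !mnormZ ler_wpM2r ?mnorm_ge0 // !ger0_norm //.
  by rewrite lef_pV2 ?posrE ?ltr0n ?fact_gt0 // ler_nat leq_fact.
rewrite -!mulr_sumr ler_wpM2l // ler_wpM2l // -[growth]mulr1.
by have := @sum_exp_coeff_le dt 0 1 eta.+1 dtT isT; rewrite expr0.
Qed.

Lemma mnorm_Atilde dt i : 0 <= dt ->
  mnorm (Atilde A dt i) <= dt * (n%:R * exp_coeff (dt * mnorm A) i).
Proof.
move=> dt0; rewrite /Atilde exprS -mulrA -scalerA mnormZ ger0_norm //.
rewrite ler_wpM2l //.
apply: le_trans (mnorm_taylor_term _ dt0).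
rewrite !mnormZ normrM !ger0_norm ?exprn_ge0 // -mulrA ler_wpM2l ?exprn_ge0 //.
rewrite ler_wpM2r ?mnorm_ge0 //.
by rewrite lef_pV2 ?posrE ?ltr0n ?fact_gt0 // ler_nat leq_fact.
Qed.

Lemma sum_mnorm_Atilde dt eta : 0 <= dt <= T ->
  \sum_(1 <= i < eta.+1) mnorm (Atilde A dt i)
    <= growth * mnorm A * dt ^+ 2.
Proof.
move=> dtT; have /andP[dt0 _] := dtT.
apply: (@le_trans _ _
  (\sum_(1 <= i < eta.+1) dt * (n%:R * exp_coeff (dt * mnorm A) i))).
  by apply: ler_sum => i _; exact: mnorm_Atilde.
rewrite -!mulr_sumr.
apply: (@le_trans _ _ (dt * (growth * (dt * mnorm A) ^+ 1))).
  by rewrite ler_wpM2l // sum_exp_coeff_le.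
by rewrite le_eqVlt; apply/predU1P; left; ring.
Qed.

Lemma inorm_scale_iE2 dt eta : 0 <= dt <= T ->
  inorm (iscale dt (iE A dt eta)) <= 4 * (growth * mnorm A * dt ^+ 2).
Proof.
move=> dtT; apply: le_trans (@inorm_scale_iE dt eta 1 dtT isT) _.
by rewrite le_eqVlt; apply/predU1P; left; ring.
Qed.

Lemma znorm_PUinf_step U dt eta : 0 <= dt <= T ->
  znorm (PUinf_step A U dt eta) <= 5 * (growth * mnorm A * dt ^+ 2) * znorm U.
Proof.
move=> dtT; apply: le_trans (znormD _ _) _.
have -> : 5 * (growth * mnorm A * dt ^+ 2) * znorm U =
    growth * mnorm A * dt ^+ 2 * znorm U
    + 4 * (growth * mnorm A * dt ^+ 2) * znorm U by ring.
apply: lerD.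
  apply: le_trans (znorm_zsum _ _ _) _.
  apply: (@le_trans _ _
    (\sum_(1 <= i < eta.+1) mnorm (Atilde A dt i) * znorm U)).
    by apply: ler_sum => i _; exact: znormM.
  by rewrite -mulr_suml ler_wpM2r ?znorm_ge0 // sum_mnorm_Atilde.
apply: le_trans (znorm_imulz _ _) _.
by rewrite ler_wpM2r ?znorm_ge0 // inorm_scale_iE2.
Qed.

Lemma znorm_PU0_step U dt : 0 <= dt ->
  znorm (PU0_step U dt) <= n%:R * dt * znorm U.
Proof.
move=> dt0; apply: le_trans (znormM _ _) _.
by rewrite -scalemx1 mnormZ mnorm1 ger0_norm // [dt * _]mulrC.
Qed.

(** The two summands of the first factor cover the two cases, [A] invertible or
    singular, in the definition of the particular solution. *)
Definition Pu_rate (u : 'cV[R]_n) : R :=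
  (mnorm (invmx A) * mnorm A + 1) * growth * mnorm u.

Lemma Pu_rate_ge0 u : 0 <= Pu_rate u.
Proof.
apply: mulr_ge0; last exact: mnorm_ge0.
apply: mulr_ge0; last exact: growth_ge0.
by rewrite addr_ge0 // mulr_ge0 ?mnorm_ge0.
Qed.

Lemma mnorm_Pu_step (u : 'cV[R]_n) dt : 0 <= dt <= T ->
  mnorm (Pu_step A u dt) <= Pu_rate u * dt.
Proof.
move=> dtT; have /andP[dt0 _] := dtT.
have i0 := mnorm_ge0 (invmx A); have u0 := mnorm_ge0 u; have A0 := mnorm_ge0 A.
have g0 := growth_ge0.
rewrite /Pu_step; case: ifP => _.
  apply: (@le_trans _ _
    (mnorm (invmx A) * (growth * (dt * mnorm A)) * mnorm u)).
    apply: le_trans (mnormM _ _) _; rewrite ler_wpM2r //.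
    apply: le_trans (mnormM _ _) _; rewrite ler_wpM2l //.
    exact: mnorm_expmAB1.
  rewrite -subr_ge0 /Pu_rate [X in 0 <= X](_ : _ = growth * mnorm u * dt).
    by rewrite !mulr_ge0.
  by ring.
apply: (@le_trans _ _ (growth * mnorm u * dt)); last first.
  rewrite -subr_ge0 /Pu_rate [X in 0 <= X](_ : _ =
    mnorm (invmx A) * mnorm A * growth * mnorm u * dt).
    by rewrite !mulr_ge0.
  by ring.
have x0 : 0 <= dt * mnorm A by rewrite mulr_ge0.
have := @mxseries_tail R n 1 (fun i => Atilde A dt i *m u)
  (dt * n%:R * mnorm u) (dt * mnorm A) 0 0.
rewrite big_geq // subr0 expr0 mul1r => le_series.
apply: (@le_trans _ _ (dt * n%:R * mnorm u * expR (dt * mnorm A))).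
  apply: le_series; rewrite ?mulr_ge0 // => k.
  apply: le_trans (mnormM _ _) _; rewrite mulrAC ler_wpM2r // -mulrA.
  exact: mnorm_Atilde.
have -> : dt * n%:R * mnorm u * expR (dt * mnorm A)
    = n%:R * expR (dt * mnorm A) * (mnorm u * dt) by ring.
by rewrite -[leRHS]mulrA ler_wpM2r ?mulr_ge0 // growth_ge.
Qed.

Lemma mnorm_gens_mx (Z : zonotope R n) : mnorm (gens_mx Z) <= znorm Z.
Proof.
rewrite /mnorm exchange_big /= /znorm (big_nth 0) big_mkord.
rewrite -[leLHS]add0r lerD ?mnorm_ge0 //; apply: ler_sum => j _.
apply: ler_sum => i _.
by rewrite big_ord_recl big_ord0 addr0 mxE.
Qed.

End StepBounds.

(** * The accumulating error is quadratic, the other one linear *)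

Section StepErrors.
Context {R : realType} {n m : nat}.
Variables (inp : reach_input R n m) (H : R) (gamma : nat).

Let A := sysA inp.
Let T := tend inp.
Let U0 := input_zono inp.
Let u := input_offset inp.
Let g := growth A T.

Definition rate_a : R := 10 * g ^+ 2 * mnorm A * znorm U0.

(** Here [H] is a bound, uniform in the step, on the size of the homogeneous
    solution, and [gamma] its number of generators. *)
Definition rate_n : R :=
  8 * g * mnorm A * H + 12 * g * mnorm u
  + Num.sqrt gamma%:R * (g * mnorm A * H)
  + g * (n%:R + 5 * g * mnorm A * T) * znorm U0.

Lemma rate_a_ge0 : 0 <= rate_a.
Proof. by rewrite !mulr_ge0 ?mnorm_ge0 ?znorm_ge0 ?growth_ge0 ?exprn_ge0. Qed.

Lemma rate_n_ge0 : 0 <= H -> 0 <= T -> 0 <= rate_n.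
Proof.
move=> H0 T0; have g0 : 0 <= g := growth_ge0 _ _.
have A0 := mnorm_ge0 A; have u0 := mnorm_ge0 u; have U00 := znorm_ge0 U0.
have s0 : 0 <= Num.sqrt gamma%:R :> R := sqrtr_ge0 _.
apply: addr_ge0; last by rewrite !mulr_ge0 // addr_ge0 ?mulr_ge0.
by apply: addr_ge0; [apply: addr_ge0|]; rewrite !mulr_ge0.
Qed.

Variable s : vars R n.
Hypothesis t_itv : 0 <= tk s <= T.
Hypothesis dt_itv : 0 <= dt s <= T.

Let err_exp_le (Z : zonotope R n) :
  err (zset (zmul (expm (tk s *: A)) Z)) <= g * znorm Z.
Proof.
apply: le_trans (err_zset_le _) _; apply: le_trans (znormM _ _) _.
by rewrite ler_wpM2r ?znorm_ge0 // mnorm_expmA.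
Qed.

(** Every term of the accumulating error carries the factor [Atilde A dt i]
    with [i >= 1] or the remainder times [dt]: the part of order [dt] of the
    input solution does not contribute. *)
Lemma derr_a_le eta : derr_a inp s eta <= rate_a * dt s ^+ 2.
Proof.
have g0 : 0 <= g := growth_ge0 _ _.
pose c := g * (5 * (g * mnorm A * dt s ^+ 2) * znorm U0).
rewrite [leRHS](_ : _ = c + c); last by rewrite /c /rate_a; ring.
apply: lerD; apply: le_trans (err_exp_le _) _; rewrite ler_wpM2l //; last first.
  exact: znorm_PUinf_step.
apply: le_trans (znormD _ _) _.
have -> : 5 * (g * mnorm A * dt s ^+ 2) * znorm U0 =
    g * mnorm A * dt s ^+ 2 * znorm U0
    + 4 * (g * mnorm A * dt s ^+ 2) * znorm U0 by ring.
apply: lerD.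
  apply: le_trans (znormM _ _) _; rewrite ler_wpM2r ?znorm_ge0 //.
  by apply: le_trans (mnorm_sum _ _ _) _; exact: sum_mnorm_Atilde.
apply: le_trans (znorm_imulz _ _) _.
by rewrite ler_wpM2r ?znorm_ge0 // inorm_scale_iE2.
Qed.

Hypothesis homog_le : znorm (homog s) <= H.
Hypothesis homog_size : size (gens (homog s)) = gamma.

Lemma derr_n_le eta : derr_n inp s eta <= rate_n * dt s.
Proof.
have g0 : 0 <= g := growth_ge0 _ _.
have /andP[d0 dT] := dt_itv.
have H0 : 0 <= H := le_trans (znorm_ge0 _) homog_le.
have C_le : err (zset (setC_step inp s eta)) <=
    4 * (g * (dt s * mnorm A)) * H + 6 * g * dt s * mnorm u.
  apply: le_trans (err_zset_le _) _; apply: le_trans (znormD _ _) _.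
  apply: lerD; apply: le_trans (znorm_imulz _ _) _.
    by rewrite ler_pM ?inorm_ge0 ?znorm_ge0 // inorm_iF.
  by rewrite znorm_vec ler_wpM2r ?mnorm_ge0 // inorm_iG.
have spec_le : Num.sqrt (size (gens (homog s)))%:R
    * norm_spec ((expm (dt s *: A) - 1%:M) *m gens_mx (homog s))
    <= Num.sqrt gamma%:R * (g * (dt s * mnorm A) * H).
  rewrite -[in leRHS]homog_size ler_wpM2l ?sqrtr_ge0 //.
  apply: le_trans (norm_spec_le _) _; apply: le_trans (mnormM _ _) _.
  rewrite ler_pM ?mnorm_ge0 ?mnorm_expmAB1 //.
  exact: le_trans (mnorm_gens_mx _) homog_le.
have U_le : derr_Utau inp s eta <=
    g * ((n%:R * dt s + 5 * (g * mnorm A * (dt s * T))) * znorm U0).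
  apply: le_trans (err_exp_le _) _; rewrite ler_wpM2l //.
  apply: le_trans (znormD _ _) _; rewrite mulrDl lerD ?znorm_PU0_step //.
  apply: le_trans (znorm_PUinf_step _ _ _ dt_itv) _.
  rewrite ler_wpM2r ?znorm_ge0 // ler_wpM2l // ler_wpM2l //.
    by rewrite mulr_ge0 ?mnorm_ge0.
  by rewrite expr2 ler_wpM2l.
rewrite /derr_n /derr_h; apply: le_trans.
  by apply: lerD U_le; apply: lerD spec_le; apply: ler_wpM2l C_le.
by rewrite le_eqVlt; apply/predU1P; left; rewrite /rate_n; ring.
Qed.

End StepErrors.

(** * The loops choosing the truncation and reduction orders *)

Section InnerLoops.
Context {R : realType} {n m : nat}.
Variables (inp : reach_input R n m) (srt : seq 'cV[R]_n -> seq 'cV[R]_n).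

(** The norms [x j] are bounded. A failing test at [j] means that [x] jumps by
    more than [c * x j], so that if every test failed the sequence would be
    increasing with all jumps at least [c * x 2 > 0]. *)
Lemma eta_found_exists (A : 'M[R]_n) (d : R) :
  0 <= d -> exists j, eta_found A d j.+2.
Proof.
move=> d0; apply: contrapT => /forallNP none.
pose x j := inorm_frob (iT A d j).
have x0 j : 0 <= x j by have /andP[] := inorm_frob_itv (iT A d j).
have x_le j : x j <= 2 * growth A d.
  have /andP[_ /le_trans] := inorm_frob_itv (iT A d j); apply.
  have dd : 0 <= d <= d by rewrite d0 lexx.
  by have := @inorm_iT _ _ A d d j 0 dd isT; rewrite expr0 mulr1.
pose c : R := 10%:R ^- 10.
have c0 : 0 < c by rewrite invr_gt0 exprn_gt0.
have jump j : c * x j.+2 < x j.+2 - x j.+1.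
  by have /negP := none j; rewrite /eta_found -ltNge.
have x2 : 0 < x 2.
  rewrite lt_neqAle x0 andbT; apply/eqP => x20.
  by have := jump 0; rewrite -x20 mulr0 sub0r oppr_gt0 ltNge x0.
have cx2 : 0 < c * x 2 by rewrite mulr_gt0.
have grow j : j%:R * (c * x 2) + x 2 <= x j.+2.
  elim: j => [|j IHj]; first by rewrite mul0r add0r.
  have x2j : x 2 <= x j.+3.
    have := jump j.+1; have := IHj; have := x0 j.+3.
    have : 0 <= j%:R * (c * x 2) by rewrite mulr_ge0 // ltW.
    have : 0 <= c * x j.+3 by rewrite mulr_ge0 // ltW.
    lra.
  have : c * x 2 <= c * x j.+3 by rewrite ler_wpM2l // ltW.
  have := jump j.+1; rewrite -[j.+1%:R]natr1 mulrDl mul1r; have := IHj; lra.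
have C0 : 0 <= 2 * growth A d / (c * x 2).
  by rewrite divr_ge0 ?mulr_ge0 ?growth_ge0 // ltW.
pose N := Num.bound (2 * growth A d / (c * x 2)).
have : 2 * growth A d < N%:R * (c * x 2).
  by rewrite -ltr_pdivrMr // /N archi_boundP.
have := grow N; have := x_le N.+2; lra.
Qed.

(** If [n > 0], the number of reduced generators at order [size + 1] is
    [size - size * n <= 0], so nothing is reduced. In dimension [0] every vector
    is zero. *)
Lemma derr_r_eventually0 (s : vars R n) :
  exists rho, derr_r inp srt s rho.+1 <= 0.
Proof.
exists (size (gens (next_PU0 inp s))); apply: le_trans (err_zset_le _) _.
rewrite /znorm mnorm0 add0r /gens_red /num_reduced.
have [n0|n_gt0] := posnP n.
  rewrite big1 // => g _; rewrite /mnorm big1 // => -[i i_lt_n] _.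
  by exfalso; rewrite n0 in i_lt_n.
rewrite ifT ?big_nil //.
rewrite -[(size _).+1%:R]natr1 addrK -natrM.
by rewrite subr_le0 floor_ge_int -pmulrn ler_nat leq_pmulr.
Qed.

Definition halts (c : control * vars R n) : Prop :=
  exists N, (iter N (step inp srt) c).1 = Done.

Lemma halts_step c : halts (step inp srt c) -> halts c.
Proof. by move=> [N HN]; exists N.+1; rewrite iterSr. Qed.

Lemma halts_FindEta s : 0 <= dt s ->
  (forall eta, halts (TestStep eta, s)) -> halts (FindEta 2, s).
Proof.
move=> d0 halts_Test; have [j found] := eta_found_exists (sysA inp) d0.
suff main i : (i <= j)%N -> halts (FindEta (j - i).+2, s).
  by have := main _ (leqnn j); rewrite subnn.
elim: i => [_|i IHi ij]; apply: halts_step; rewrite /step /=.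
  by rewrite subn0 found.
by case: ifP => // _; rewrite -subSn // subSS; apply: IHi; exact: ltnW.
Qed.

Lemma halts_FindRho s eta : 0 <= step_bound_r inp s ->
  (forall rho, derr_r inp srt s rho <= step_bound_r inp s ->
     halts (While, next_vars inp srt s eta rho)) ->
  halts (FindRho eta 0, s).
Proof.
move=> b0 halts_next; have [r r_le] := derr_r_eventually0 s.
suff main i : (i <= r)%N -> halts (FindRho eta (r - i), s).
  by have := main _ (leqnn r); rewrite subnn.
elim: i => [_|i IHi ir]; apply: halts_step; rewrite /step /=.
  have r_ok : derr_r inp srt s r.+1 <= step_bound_r inp s := le_trans r_le b0.
  by rewrite subn0 r_ok; exact: halts_next.
case: ifP => [|_]; first exact: halts_next.
by rewrite -subSn // subSS; apply: IHi; exact: ltnW.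
Qed.

End InnerLoops.

(** * The step size loop and the main loop *)

Section MainLoop.
Context {R : realType} {n m : nat}.
Variables (inp : reach_input R n m) (srt : seq 'cV[R]_n -> seq 'cV[R]_n).
Hypotheses (tend_gt0 : 0 < tend inp) (emax_gt0 : 0 < emax inp).
Hypotheses (zeta_ge0 : 0 <= zeta inp) (zeta_lt1 : zeta inp < 1).

Let A := sysA inp.
Let T := tend inp.
Let g := growth A T.
Let v := Pu_rate A T (input_offset inp).

(** The first summand covers the initial state, in which the homogeneous
    solution is the initial set itself; the others bound its image under the
    exponential and the particular solution accumulated up to time [T]. *)
Definition homog_bound : R :=
  znorm (initX inp) + g * znorm (initX inp) + g * v * T.

Let g_ge0 : 0 <= g := growth_ge0 A T.
Let v_ge0 : 0 <= v := Pu_rate_ge0 A T _.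
Let X_ge0 : 0 <= znorm (initX inp) := znorm_ge0 _.
Let T_ge0 : 0 <= T := ltW tend_gt0.

Lemma homog_bound_ge0 : 0 <= homog_bound.
Proof.
apply: addr_ge0; last by rewrite (mulr_ge0 _ T_ge0) // mulr_ge0.
by rewrite addr_ge0 // mulr_ge0.
Qed.

(** One constant for both errors, made positive by the last summand. *)
Definition err_rate : R :=
  rate_a inp + rate_n inp homog_bound (size (gens (initX inp))) + 1.

Lemma err_rate_gt0 : 0 < err_rate.
Proof.
by rewrite ltr_wpDl // addr_ge0 ?rate_a_ge0 ?rate_n_ge0 ?homog_bound_ge0.
Qed.

(** The admissible accumulating error grows by this amount per unit of time. *)
Definition budget_rate : R := (1 - zeta inp) * emax inp / T.

Lemma budget_rate_gt0 : 0 < budget_rate.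
Proof. by rewrite divr_gt0 // mulr_gt0 // subr_gt0. Qed.

Lemma bound_aE t : bound_a inp t = budget_rate * t.
Proof. by rewrite /bound_a /budget_rate; ring. Qed.

Lemma le_bound_r t t' : t <= t' -> bound_r inp t <= bound_r inp t'.
Proof.
move=> tt'; rewrite /bound_r !ler_wpM2r // ?invr_ge0 //; exact: ltW.
Qed.

(** The bound on [Pu] proportional to the elapsed time is what makes the bound
    on the homogeneous solution uniform: the number of steps is unknown. *)
Record invariant (s : vars R n) : Prop := Invariant {
  inv_tk : 0 <= tk s;
  inv_Pu : mnorm (Pu s) <= g * v * tk s;
  inv_homog : znorm (homog s) <= homog_bound;
  inv_size : size (gens (homog s)) = size (gens (initX inp));
  inv_erra : erra s <= bound_a inp (tk s);
  inv_errr : errr s <= bound_r inp (tk s) }.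

Lemma invariant_with_dt s d : invariant s -> invariant (with_dt s d).
Proof. by case. Qed.

Lemma invariant_next s eta rho :
  invariant s -> 0 <= dt s -> tk s + dt s <= T ->
  derr_a inp s eta <= step_bound_a inp s ->
  derr_r inp srt s rho <= step_bound_r inp s ->
  invariant (next_vars inp srt s eta rho).
Proof.
move=> [t0 Pu_le _ _ _ _] d0 tT a_ok r_ok.
have tT' : tk s <= T by rewrite (le_trans _ tT) // lerDl.
have dT : dt s <= T by rewrite (le_trans _ tT) // lerDr.
have t'0 : 0 <= tk s + dt s by rewrite addr_ge0.
have Pu'_le : mnorm (Pu (next_vars inp srt s eta rho)) <= g * v * (tk s + dt s).
  apply: le_trans (mnormD _ _) _; rewrite mulrDr lerD // -mulrA.
  apply: le_trans (mnormM _ _) _.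
  rewrite ler_pM ?mnorm_ge0 ?mnorm_expmA ?mnorm_Pu_step //.
    by rewrite t0.
  by rewrite d0.
split => //.
- apply: le_trans (znormD _ _) _; rewrite znorm_vec.
  apply: (@le_trans _ _ (g * znorm (initX inp) + g * v * T)); last first.
    by rewrite /homog_bound -[leRHS]addrA lerDr.
  apply: lerD.
    apply: le_trans (znormM _ _) _; rewrite ler_wpM2r // mnorm_expmA //.
    by rewrite t'0.
  by apply: le_trans Pu'_le _; rewrite ler_wpM2l // mulr_ge0.
- by rewrite /= cats0 size_map.
- by rewrite /= -lerBrDl.
- by rewrite /= -lerBrDl.
Qed.

(** The part of the admissible accumulating error that is still unused. *)
Definition slack (s : vars R n) : R := bound_a inp (tk s) - erra s.

(** The first condition suffices for the accumulating error, since its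
    quadratic bound is then below the budget earned during the step. For the
    other error, the admissible value is at least
    [emax - bound_r T - erra], which is [budget_rate * (T - tk) + slack]. *)
Lemma step_test_passes s eta : invariant s ->
  0 <= dt s -> tk s + dt s <= T ->
  err_rate * dt s <= budget_rate ->
  err_rate * dt s <= budget_rate * (T - tk s) + slack s ->
  derr_a inp s eta <= step_bound_a inp s
  /\ derr_n inp s eta <= step_bound_n inp s.
Proof.
move=> [t0 _ hH hS ea _] d0 tT Kc Kslack.
have tT' : 0 <= tk s <= T by rewrite t0 (le_trans _ tT) // lerDl.
have dT : 0 <= dt s <= T by rewrite d0 (le_trans _ tT) // lerDr.
have ra0 := rate_a_ge0 inp.
have rn0 := rate_n_ge0 (size (gens (initX inp))) homog_bound_ge0 T_ge0.
have sl0 : 0 <= slack s by rewrite subr_ge0.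
split.
  apply: le_trans (derr_a_le tT' dT eta) _; rewrite expr2 mulrA.
  rewrite /step_bound_a bound_aE mulrDr addrAC -bound_aE -[leLHS]add0r lerD //.
  rewrite ler_wpM2r // (le_trans _ Kc) // ler_wpM2r // /err_rate.
  by rewrite -addrA lerDl addr_ge0.
apply: le_trans (derr_n_le tT' dT hH hS eta) _.
apply: (@le_trans _ _ (err_rate * dt s)).
  by rewrite ler_wpM2r // /err_rate addrAC lerDr addr_ge0.
apply: le_trans Kslack _; rewrite /step_bound_n /slack bound_aE.
have -> : budget_rate * (T - tk s) + (budget_rate * tk s - erra s)
  = emax inp - bound_r inp T - erra s.
  by rewrite /budget_rate /bound_r /T; field; rewrite gt_eqF.
by rewrite lerD2r lerD2l lerN2 le_bound_r.
Qed.

(** The step sizes of the algorithm: the doubling at the start of a step is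
    undone by the halving that follows. *)
Definition grid (q : nat) : R := T / 2 ^+ q.

Lemma grid_gt0 q : 0 < grid q.
Proof. by rewrite divr_gt0 ?exprn_gt0. Qed.

Lemma gridS q : grid q = 2 * grid q.+1.
Proof. by rewrite /grid exprS; field; rewrite expf_neq0. Qed.

Lemma grid_refine q q' : (q <= q')%N -> grid q = (2 ^ (q' - q))%:R * grid q'.
Proof.
move=> qq'; rewrite natrX /grid -{2}(subnK qq') exprD.
by field; rewrite !expf_neq0.
Qed.

Lemma grid_le q q' : (q <= q')%N -> grid q' <= grid q.
Proof.
move=> qq'; rewrite (grid_refine qq') ler_peMl ?ler1n ?expn_gt0 //.
exact: ltW (grid_gt0 _).
Qed.

Lemma grid_small e : 0 < e ->
  exists Q, forall q, (Q <= q)%N -> err_rate * grid q <= e.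
Proof.
move=> e0; exists (Num.bound (err_rate * T / e)) => q /upper_nthrootP.
rewrite ltr_pdivrMr // => lt_e.
by rewrite /grid mulrA ler_pdivrMr ?exprn_gt0 // [leRHS]mulrC ltW.
Qed.

(** The remaining time stays a multiple of the step size. Counted in units of
    any [grid Q] at least as fine as all step sizes in use, it strictly
    decreases; this is the measure on which the main loop is proved to stop. *)
Lemma remaining_decr q q' k t : (q <= q')%N ->
  T - t = k.+1%:R * grid q ->
  exists k', T - (t + grid q') = k'%:R * grid q' /\
    forall Q, (q' <= Q)%N -> (k' * 2 ^ (Q - q') < k.+1 * 2 ^ (Q - q))%N.
Proof.
move=> qq' Tt.
have k0 : (0 < k.+1 * 2 ^ (q' - q))%N by rewrite muln_gt0 expn_gt0.
exists (k.+1 * 2 ^ (q' - q)).-1; split.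
  rewrite opprD addrA Tt (grid_refine qq') mulrA -natrM.
  by rewrite -{1}(prednK k0) -natr1 mulrDl mul1r addrK.
move=> Q q'Q.
have -> : (Q - q = (q' - q) + (Q - q'))%N by rewrite addnC addnBA // subnK.
by rewrite expnD mulnA ltn_pmul2r ?expn_gt0 // prednK.
Qed.

(** If all step sizes from the grid index [Q] on pass the test, the loop stops
    at an index at most [maxn q Q]; where it stops does not matter to the main
    loop, so the continuation is required for every index up to there. *)
Lemma halts_Halve s q Q : invariant s ->
  tk s + grid q <= T ->
  (forall q' eta, (Q <= q')%N -> (q <= q')%N ->
     let s' := with_dt s (grid q') in
     derr_a inp s' eta <= step_bound_a inp s'
     /\ derr_n inp s' eta <= step_bound_n inp s') ->
  (forall q' eta rho, (q <= q' <= maxn q Q)%N ->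
     let s' := with_dt s (grid q') in
     derr_a inp s' eta <= step_bound_a inp s' ->
     derr_r inp srt s' rho <= step_bound_r inp s' ->
     halts inp srt (While, next_vars inp srt s' eta rho)) ->
  halts inp srt (Halve, with_dt s (2 * grid q)).
Proof.
move=> inv_s; have [j] := ubnP (Q - q).
elim: j q => // j IHj q lt_j tT passes next.
apply: halts_step; rewrite /step /=.
have -> : with_dt (with_dt s (2 * grid q)) (2^-1 * (2 * grid q))
        = with_dt s (grid q) by rewrite /with_dt /= mulKf.
apply: halts_FindEta => [|eta]; first exact: ltW (grid_gt0 _).
apply: halts_step; rewrite /step /=; case: ifP => [/andP[a_ok _]|/negbT fails].
  apply: halts_FindRho => [|rho r_ok]; last first.
    by apply: (next q eta rho) => //; rewrite leqnn leq_maxl.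
  rewrite /step_bound_r /= subr_ge0 (le_trans (inv_errr inv_s)) //.
  by rewrite le_bound_r // lerDl ltW ?grid_gt0.
have qQ : (q < Q)%N.
  rewrite ltnNge; apply/negP => Qq.
  by case: (passes q eta Qq (leqnn q)) => ha hn; move: fails; rewrite ha hn.
rewrite gridS; apply: IHj => [|||q' eta' rho'].
- by rewrite subnS prednK ?subn_gt0 // -ltnS.
- by apply: le_trans tT; rewrite lerD2l grid_le.
- by move=> q' eta' Qq' qq'; apply: passes => //; exact: ltnW.
- move=> /andP[qq' q'Q]; apply: next; rewrite (ltnW qq') /=.
  by move: q'Q; rewrite (maxn_idPr qQ) (maxn_idPr (ltnW qQ)).
Qed.

Lemma derr_a_grid s eta q : invariant s -> tk s + grid q <= T ->
  derr_a inp (with_dt s (grid q)) eta <= err_rate * grid q * grid q.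
Proof.
move=> [t0 _ _ _ _ _] tT; have d0 := grid_gt0 q.
have tT' : 0 <= tk s <= T by rewrite t0 (le_trans _ tT) // lerDl ltW.
have dT : 0 <= grid q <= T by rewrite ltW //= (le_trans _ tT) // lerDr.
apply: le_trans (@derr_a_le _ _ _ inp (with_dt s (grid q)) tT' dT eta) _.
rewrite /= expr2 mulrA ler_wpM2r ?(ltW d0) // ler_wpM2r ?(ltW d0) //.
rewrite /err_rate -addrA lerDl addr_ge0 // rate_n_ge0 //.
exact: homog_bound_ge0.
Qed.

(** One turn of the main loop. The last premise of the continuation records
    that the slack grows by the earned budget minus the quadratic bound on the
    accumulating error. *)
Lemma halts_While s q k Q :
  invariant s -> dt s = grid q -> T - tk s = k%:R * grid q ->
  (tk s < T -> forall q', (Q <= q')%N ->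
     err_rate * grid q' <= budget_rate /\
     err_rate * grid q' <= budget_rate * (T - tk s) + slack s) ->
  (forall q' k' s', (q <= q' <= maxn q Q)%N -> invariant s' ->
     dt s' = grid q' -> T - tk s' = k'%:R * grid q' ->
     (forall Q', (q' <= Q')%N -> (k' * 2 ^ (Q' - q') < k * 2 ^ (Q' - q))%N) ->
     slack s + (budget_rate - err_rate * grid q') * grid q' <= slack s' ->
     halts inp srt (While, s')) ->
  halts inp srt (While, s).
Proof.
move=> inv_s dt_q; case: k => [|k] t_k small next.
  exists 1%N; rewrite /= /step /= ltNge -subr_le0 -/T.
  by rewrite t_k mul0r lexx.
have t_lt_T : tk s < T.
  by rewrite -subr_gt0 t_k mulr_gt0 ?grid_gt0 ?ltr0n.
have tT q' : (q <= q')%N -> tk s + grid q' <= T.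
  move=> qq'; rewrite -lerBrDl t_k (le_trans (grid_le qq')) //.
  by rewrite ler_peMl ?ler1n // ltW ?grid_gt0.
apply: halts_step; rewrite /step /= t_lt_T dt_q.
apply: (@halts_Halve s q Q) => // [|q' eta Qq' qq'|q' eta rho /andP[qq' q'Q]].
- exact: tT.
- have [small_a small_n] := small t_lt_T q' Qq'.
  apply: step_test_passes => //; first exact: invariant_with_dt.
    exact: ltW (grid_gt0 _).
  exact: tT.
move=> s' a_ok r_ok.
have [k' [t_k' decr]] := remaining_decr qq' t_k.
apply: (next q' k') => //.
- by rewrite qq'.
- apply: invariant_next => //; first exact: invariant_with_dt.
    exact: ltW (grid_gt0 _).
  exact: tT.
have := derr_a_grid eta inv_s (tT _ qq').
rewrite /slack !bound_aE /= -/s' mulrDr; lra.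
Qed.

(** Steps with [err_rate * dt <= budget_rate] never decrease the slack, so every
    step size with moreover [err_rate * dt <= delta] passes. Hence the grid
    indices never exceed a fixed [M], and the remaining time in units of
    [grid M] decreases. *)
Lemma halts_with_slack s q k delta :
  invariant s -> dt s = grid q -> T - tk s = k%:R * grid q ->
  err_rate * grid q <= budget_rate -> 0 < delta <= slack s ->
  halts inp srt (While, s).
Proof.
move=> inv_s dt_q t_k Kc /andP[delta0 slack_s].
have [Q Q_delta] := grid_small delta0.
have [j] := ubnP (k * 2 ^ (maxn q Q - q)); have := leq_maxl q Q.
have := leq_maxr q Q; move: (maxn q Q) => M QM qM.
elim: j s q k qM inv_s dt_q t_k Kc slack_s => // j IHj s q k.
move=> qM inv_s dt_q t_k Kc slack_s lt_j.
have K0 := err_rate_gt0.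
have c0 := budget_rate_gt0.
apply: (@halts_While s q k (maxn q Q)) => //.
  move=> t_lt q'; rewrite geq_max => /andP[qq' Qq']; split.
    by rewrite (le_trans _ Kc) // ler_wpM2l ?(ltW K0) // grid_le.
  rewrite (le_trans (Q_delta _ Qq')) // (le_trans slack_s) // lerDr.
  by rewrite mulr_ge0 ?(ltW c0) // subr_ge0 ltW.
move=> q' k' s' /andP[qq' q'Q] inv_s' dt_q' t_k' decr slack_s'.
have q'M : (q' <= M)%N by rewrite (leq_trans q'Q) // !geq_max qM QM.
have Kc' : err_rate * grid q' <= budget_rate.
  by rewrite (le_trans _ Kc) // ler_wpM2l ?(ltW K0) // grid_le.
apply: (IHj s' q' k') => //.
  rewrite (le_trans slack_s) // (le_trans _ slack_s') // lerDl.
  by rewrite mulr_ge0 ?subr_ge0 // ltW ?grid_gt0.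
exact: leq_trans (decr _ q'M) lt_j.
Qed.

(** Without slack the admissible non-accumulating error may shrink with the
    remaining time, so no step size is known to pass at all later steps. Either
    the indices never exceed [Q], and the remaining time in units of [grid Q]
    decreases; or a step finer than [grid Q] is made. The accumulating error of
    such a step is at most half of the budget that it earns, so the other half
    becomes slack. *)
Lemma halts_on_grid s q k :
  invariant s -> dt s = grid q -> T - tk s = k%:R * grid q ->
  halts inp srt (While, s).
Proof.
have c0 := budget_rate_gt0; have K0 := err_rate_gt0.
have c20 : 0 < budget_rate / 2 by rewrite divr_gt0.
have [Q0 Q0_c] := grid_small c20.
have {Q0_c} [Q qQ Q_c] : exists2 Q, (q <= Q)%N &
    forall q', (Q <= q')%N -> err_rate * grid q' <= budget_rate / 2.
  exists (maxn q Q0); first exact: leq_maxl.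
  by move=> q'; rewrite geq_max => /andP[_]; exact: Q0_c.
move=> inv_s dt_q t_k; have [j] := ubnP (k * 2 ^ (Q - q)).
elim: j s q k qQ inv_s dt_q t_k => // j IHj s q k qQ inv_s dt_q t_k lt_j.
have slack0 : 0 <= slack s by rewrite subr_ge0 (inv_erra inv_s).
(* This threshold depends on the remaining time; it only serves to leave the
   step size loop in the current step. *)
have [Q1 Q1_small] : exists Q1, tk s < T -> forall q', (Q1 <= q')%N ->
    err_rate * grid q' <= budget_rate * (T - tk s).
  have [t_lt|] := boolP (tk s < T); last by exists 0.
  have e0 : 0 < budget_rate * (T - tk s) by rewrite mulr_gt0 // subr_gt0.
  by have [Q1 ?] := grid_small e0; exists Q1.
apply: (@halts_While s q k (maxn Q Q1)) => //.
  move=> t_lt q'; rewrite geq_max => /andP[Qq' Q1q']; split.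
    rewrite (le_trans (Q_c _ Qq')) // ler_pdivrMr //.
    by rewrite ler_peMr ?(ltW c0) ?ler1n.
  by rewrite (le_trans (Q1_small t_lt _ Q1q')) // lerDl.
move=> q' k' s' /andP[qq' _] inv_s' dt_q' t_k' decr slack_s'.
have [q'Q|Qq'] := leqP q' Q.
  by apply: (IHj s' q' k') => //; exact: leq_trans (decr _ q'Q) lt_j.
have Kc2 := Q_c _ (ltnW Qq').
have g0 := grid_gt0 q'.
apply: (@halts_with_slack s' q' k' (budget_rate / 2 * grid q')) => //.
  by rewrite (le_trans Kc2) // ler_pdivrMr // ler_peMr ?(ltW c0) ?ler1n.
rewrite mulr_gt0 //= (le_trans _ slack_s') // ler_wpDl //.
rewrite ler_wpM2r ?(ltW g0) //; lra.
Qed.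

End MainLoop.

Theorem theorem1 (R : realType) (n m : nat)
  (A : 'M[R]_n) (B : 'M[R]_(n, m)) (p : 'cV[R]_n)
  (X0 : zonotope R n) (U : zonotope R m) (tend zeta : R)
  (srt : seq 'cV[R]_n -> seq 'cV[R]_n)
  (tend_gt0 : 0 < tend) (zeta_ge0 : 0 <= zeta) (zeta_lt1 : zeta < 1)
  (srtP : sorts_generators srt) :
  forall emax : R, 0 < emax ->
    terminates (ReachInput A B p X0 U tend zeta emax) srt.
Proof.
move=> emax emax_gt0.
set inp := ReachInput A B p X0 U tend zeta emax.
apply: (@halts_on_grid R n m inp srt tend_gt0 emax_gt0 zeta_ge0 zeta_lt1
          _ 0 1).
- split => //=.
  + by rewrite mnorm0 mulr0.
  + rewrite /homog_bound -addrA lerDl addr_ge0 //.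
      by apply: mulr_ge0; [exact: growth_ge0 | exact: znorm_ge0].
    apply: mulr_ge0; last exact: ltW.
    by apply: mulr_ge0; [exact: growth_ge0 | exact: Pu_rate_ge0].
  + by rewrite /bound_a !mul0r.
  + by rewrite /bound_r !mul0r.
- by rewrite /= /grid divr1.
- by rewrite /= /grid subr0 divr1 mul1r.
Qed.
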